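(* Let $\delta>0$. Suppose that $(\mathcal{A},\mathcal{B},\mathcal{C})$ satisfies Assumptions 1 and 2 (recalled in the context). Let $K_0\in\mathbb{C}^{n_u\times n_0}$, $G_0\in\mathbb{C}^{n_0\times n_y}$ and a Hermitian positive definite $P_0\in\mathbb{C}^{2n_0\times 2n_0}$ satisfy $$P_0F_0+F_0^\ast P_0\prec -2\delta P_0,\qquad F_0=\begin{bmatrix}A_0+B_0K_0 & -G_0C_0\\ 0 & A_0+G_0C_0\end{bmatrix}.$$ If there exists an integer $n\ge n_0+n_1$ such that the decomposed form of order $n$ of the system satisfies $$\varrho_n:=\frac{16\,\sum_{i\in\mathbb{N}}\bar\sigma\big(K_0^\ast b_i^\ast b_iK_0\big)\;\sum_{i\in\mathbb{N}}\bar\sigma\left(c_i^\ast\begin{bmatrix}-G_0\\ G_0\end{bmatrix}^\ast P_0\begin{bmatrix}-G_0\\ G_0\end{bmatrix}c_i\right)}{\delta^2\,\underline\sigma(P_0)\,\big(|\underline\sigma(A_1)|-\delta\big)\,|\underline\sigma(A_1)|}\le 1,$$ then the closed-loop system formed by the decomposed system of order $n$ and the controller $\frac{\mathrm d}{\mathrm dt}\hat x=L\hat x+My+Nu$, $u=K\hat x$, with $$L=\begin{bmatrix}A_0+G_0C_0 & G_0C_1\\0&A_1\end{bmatrix},\quad M=\begin{bmatrix}-G_0\\0\end{bmatrix},\quad N=\begin{bmatrix}B_0\\ B_1\end{bmatrix},\quad K=\begin{bmatrix}K_0&0\end{bmatrix},$$ is exponentially stable with decay rate $\delta$.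
   Context: Notation. $|\cdot|$ is the Euclidean norm on $\mathbb{C}^n$ and $\|\cdot\|$ the norm of $\ell_2(\mathbb{N})$ (square summable complex sequences). $M^\ast$ is the conjugate transpose. For a square matrix $M$, $\underline\sigma(M)$ and $\bar\sigma(M)$ are the minimal and maximal real parts of its eigenvalues. $M\succ0$ means Hermitian positive definite; $M\prec N$ means $N-M\succ0$. System. On $\ell_2(\mathbb{N})$ consider $\frac{\mathrm d}{\mathrm dt}x=\mathcal{A}x+\mathcal{B}u$, $y=\mathcal{C}x$, $t\ge0$, where $\mathcal{A}:D(\mathcal{A})\subset\ell_2(\mathbb{N})\to\ell_2(\mathbb{N})$ has generalized eigenvectors $\{\upsilon_k\}_{k\in\mathbb{N}}$ forming a Riesz basis, and $\mathcal{B}:\mathbb{R}^{n_u}\to\ell_2(\mathbb{N})$, $\mathcal{C}:\ell_2(\mathbb{N})\to\mathbb{R}^{n_y}$ are bounded. Assumption 1: for any $\delta>0$ there is $n\in\mathbb{N}$ such that the generalized eigenvectors $\upsilon_k$, $k\ge n$, are associated to algebraically simple eigenvalues with real parts smaller than $-\delta$. Assumption 2: the pair $(\mathcal{A},\mathcal{B})$ is exactly controllable and the pair $(\mathcal{C},\mathcal{A})$ is exactly observable. Decomposed form of order $n$. Given $\delta>0$, let $n_0$ be the number of eigenvalues of $\mathcal{A}$ (repeated with multiplicity) with real part $\ge-\delta$, and $n_1$ the number of eigenvalues (repeated with multiplicity) with real part $<-\delta$ that are algebraically multiple. For an integer $n\ge n_0+n_1$, up to a continuous, bijective linear change of variable $\ell_2(\mathbb{N})\to\mathbb{C}^n\times\ell_2(\mathbb{N})$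 with continuous inverse (Jordan normalization and ordering of eigenvalues by decreasing real part), the system reads $$\tfrac{\mathrm d}{\mathrm dt}\begin{bmatrix}x_0\\ x_1\end{bmatrix}=\begin{bmatrix}A_0&0\\0&A_1\end{bmatrix}\begin{bmatrix}x_0\\ x_1\end{bmatrix}+\begin{bmatrix}B_0\\ B_1\end{bmatrix}u,\qquad \tfrac{\mathrm d}{\mathrm dt}z_i=a_iz_i+b_iu\ (i\in\mathbb{N}),\qquad y=\begin{bmatrix}C_0&C_1\end{bmatrix}\begin{bmatrix}x_0\\ x_1\end{bmatrix}+\sum_{i\in\mathbb{N}}c_iz_i,$$ with $A_0\in\mathbb{C}^{n_0\times n_0}$, $A_1\in\mathbb{C}^{(n-n_0)\times(n-n_0)}$, $a_i\in\mathbb{C}$ in complex Jordan normal form, $\bar\sigma(A_1)<-\delta$, $\mathrm{Re}(a_i)<\underline\sigma(A_1)$, $B_0\in\mathbb{C}^{n_0\times n_u}$, $B_1\in\mathbb{C}^{(n-n_0)\times n_u}$, $b_i\in\mathbb{C}^{1\times n_u}$, $C_0\in\mathbb{C}^{n_y\times n_0}$, $C_1\in\mathbb{C}^{n_y\times(n-n_0)}$, $c_i\in\mathbb{C}^{n_y\times1}$, $(z_i)\in\ell_2(\mathbb{N})$. ($A_1$ is nonempty, so that $\underline\sigma(A_1)$ makes sense.) By boundedness of $\mathcal{B},\mathcal{C}$, $\sum_i|b_i|^2<\infty$ and $\sum_i|c_i|^2<\infty$. Signals and gains may be complex-valued in these coordinates. Exponential stability with decay rate $\delta$ means: there is $\kappa\ge1$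 such that all closed-loop solutions satisfy, with $x=(x_0,x_1)$, $$|x(t)|^2+\|(z_i(t))\|^2+|\hat x(t)|^2\le\kappa e^{-\delta t}\big(|x(0)|^2+\|(z_i(0))\|^2+|\hat x(0)|^2\big),\quad t\ge0.$$ *)

(* Defs.v *)
From mathcomp Require Import all_boot all_order all_algebra.
From mathcomp Require Import spectral sesquilinear.
From mathcomp.real_closed Require Import complex.
From mathcomp Require Import all_classical all_reals all_analysis.

Set Implicit Arguments.
Unset Strict Implicit.
Unset Printing Implicit Defensive.

Import Order.TTheory GRing.Theory Num.Theory.
Import numFieldNormedType.Exports.

Local Open Scope classical_set_scope.
Local Open Scope complex_scope.
Local Open Scope sesquilinear_scope.
Local Open Scope ring_scope.

Section Complex.
Variable R : realType.

Definition sqmod (w : R[i]) : R := complex.Re w ^+ 2 + complex.Im w ^+ 2.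

Definition sqnorm n (v : 'cV[R[i]]_n) : R := \sum_(i < n) sqmod (v i 0).

(* Only meaningful when the real and imaginary series both converge. *)
Definition csum (f : nat -> R[i]) : R[i] :=
  limn (series (fun i => complex.Re (f i)))
  +i* limn (series (fun i => complex.Im (f i))).

Definition cintegral (D : set R) (f : R -> R[i]) : R[i] :=
  (\int[lebesgue_measure]_(t in D) complex.Re (f t))%R
  +i* (\int[lebesgue_measure]_(t in D) complex.Im (f t))%R.

Definition has_cderive (f : R -> R[i]) (t : R) (d : R[i]) : Prop :=
  is_derive t 1 (fun s => complex.Re (f s)) (complex.Re d) /\
  is_derive t 1 (fun s => complex.Im (f s)) (complex.Im d).

Definition ccontinuous_within (D : set R) (f : R -> R[i]) : Prop :=
  {within D, continuous (fun s => complex.Re (f s))} /\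
  {within D, continuous (fun s => complex.Im (f s))}.

End Complex.

Section Matrices.
Variable R : realType.

(* By the conventions [sup set0 = inf set0 = 0], these are 0 on the empty
   matrix. *)
Definition sigma_max n (M : 'M[R[i]]_n) : R :=
  sup [set complex.Re a | a in [set a | eigenvalue M a]].

Definition sigma_min n (M : 'M[R[i]]_n) : R :=
  inf [set complex.Re a | a in [set a | eigenvalue M a]].

(* The order of R[i] makes [0 < w] entail that [w] is real. *)
Definition posdef n (M : 'M[R[i]]_n) : Prop :=
  M \is hermsymmx /\
  forall v : 'cV[R[i]]_n, v != 0 -> 0 < (v^t* *m M *m v) 0 0.

Definition mxprec n (M N : 'M[R[i]]_n) : Prop := posdef (N - M).

Definition jordan n (M : 'M[R[i]]_n) : Prop :=
  forall i j : 'I_n,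
    (j != i -> j != i.+1 :> nat -> M i j = 0) /\
    (j = i.+1 :> nat -> M i j = 0 \/ (M i j = 1 /\ M i i = M j j)).

End Matrices.

Section Operators.
Variable R : realType.

Definition l2 (z : nat -> R[i]) : Prop :=
  cvgn (series (fun i => sqmod (z i))).

Definition l2sq (z : nat -> R[i]) : R :=
  limn (series (fun i => sqmod (z i))).

Record operator := Operator {
  dom : set (nat -> R[i]);
  act : (nat -> R[i]) -> nat -> R[i] }.

Definition linear_operator (A : operator) : Prop :=
  [/\ dom A (fun=> 0),
      forall x, dom A x -> l2 x /\ l2 (act A x) &
      forall (s : R[i]) x y, dom A x -> dom A y ->
        dom A (fun i => s * x i + y i) /\
        act A (fun i => s * x i + y i) = (fun i => s * act A x i + act A y i)].

(* [x] is in the domain of (A - s)^m and is annihilated by it. *)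
Fixpoint in_kernel_pow (A : operator) (s : R[i]) m (x : nat -> R[i]) : Prop :=
  if m is m'.+1 then
    dom A x /\ in_kernel_pow A s m' (fun i => act A x i - s * x i)
  else x = (fun=> 0).

Definition generalized_kernel (A : operator) (s : R[i]) :
  set (nat -> R[i]) := [set x | exists m, in_kernel_pow A s m x].

Definition generalized_eigenvector A s (x : nat -> R[i]) : Prop :=
  generalized_kernel A s x /\ x <> (fun=> 0).

Definition is_eigenvalue (A : operator) (s : R[i]) : Prop :=
  exists x, [/\ dom A x, x <> (fun=> 0) & act A x = (fun i => s * x i)].

(* The generalized kernel of A - s has dimension [m]. *)
Definition algebraic_multiplicity A s m : Prop :=
  exists v : 'I_m -> nat -> R[i],
    (forall c : 'I_m -> R[i],
       (fun i => \sum_(k < m) c k * v k i) = (fun=> 0) ->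
       forall k, c k = 0) /\
    (forall x, generalized_kernel A s x <->
       exists c : 'I_m -> R[i], x = (fun i => \sum_(k < m) c k * v k i)).

Definition algebraically_simple A s : Prop :=
  is_eigenvalue A s /\ algebraic_multiplicity A s 1.

Definition algebraically_multiple A s : Prop :=
  is_eigenvalue A s /\ ~ algebraic_multiplicity A s 1.

(* The eigenvalues satisfying [P], repeated with algebraic multiplicity, are
   finitely many and their number is [n]. *)
Definition number_of_eigenvalues A (P : R[i] -> Prop) (n : nat) : Prop :=
  exists (e : seq R[i]) (mu : R[i] -> nat),
    [/\ uniq e,
        forall s, s \in e <-> is_eigenvalue A s /\ P s,
        forall s, s \in e -> algebraic_multiplicity A s (mu s) &
        n = (\sum_(s <- e) mu s)%N].

Definition riesz_basis (v : nat -> nat -> R[i]) : Prop :=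
  [/\ forall k, l2 (v k),
      forall x, l2 x -> forall eps : R, 0 < eps ->
        exists N (c : 'I_N -> R[i]),
          l2sq (fun i => x i - \sum_(k < N) c k * v k i) < eps &
      exists m M : R, [/\ 0 < m, 0 < M &
        forall N (c : 'I_N -> R[i]),
          m * \sum_(k < N) sqmod (c k)
            <= l2sq (fun i => \sum_(k < N) c k * v k i)
            <= M * \sum_(k < N) sqmod (c k)]].

Definition generalized_eigenbasis A (v : nat -> nat -> R[i]) : Prop :=
  (forall k, exists s, generalized_eigenvector A s (v k)) /\ riesz_basis v.

(* Signals being complex valued, the input and output operators are taken
   between complex spaces (an operator on real inputs is complexified). *)
Definition bounded_input nu (B : 'cV[R[i]]_nu -> nat -> R[i]) : Prop :=
  [/\ forall u, l2 (B u),
      forall (s : R[i]) u v, B (s *: u + v) = (fun i => s * B u i + B v i) &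
      exists M : R, forall u, l2sq (B u) <= M * sqnorm u].

Definition bounded_output ny (C : (nat -> R[i]) -> 'cV[R[i]]_ny) : Prop :=
  (forall (s : R[i]) x y, l2 x -> l2 y ->
     C (fun i => s * x i + y i) = s *: C x + C y) /\
  exists M : R, forall x, l2 x -> sqnorm (C x) <= M * l2sq x.

Definition eventually_simple_stable A (v : nat -> nat -> R[i]) : Prop :=
  forall d : R, 0 < d -> exists n : nat, forall k, (n <= k)%N ->
    exists s, [/\ generalized_eigenvector A s (v k),
                  algebraically_simple A s & complex.Re s < - d].

(* [S] is the strongly continuous semigroup with generator [A]. *)
Definition generates A (S : R -> (nat -> R[i]) -> nat -> R[i]) : Prop :=
  [/\ forall t : R, 0 <= t ->
        [/\ forall x, l2 x -> l2 (S t x),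
            forall (s : R[i]) x y, l2 x -> l2 y ->
              S t (fun i => s * x i + y i) = (fun i => s * S t x i + S t y i) &
            exists M : R, forall x, l2 x -> l2sq (S t x) <= M * l2sq x],
      forall x, l2 x -> S 0 x = x,
      forall t s : R, 0 <= t -> 0 <= s ->
        forall x, l2 x -> S (t + s) x = S t (S s x),
      forall x, l2 x -> l2sq (fun i => S t x i - x i) @[t --> 0^'+] --> (0 : R) &
      forall x y, (dom A x /\ act A x = y) <->
        [/\ l2 x, l2 y &
            l2sq (fun i => (S t x i - x i) / t%:C - y i)
              @[t --> 0^'+] --> (0 : R)]].

(* States reached at time [tau] from the origin by inputs in
   L^2(0, tau; C^nu). *)
Definition reachable S nu (B : 'cV[R[i]]_nu -> nat -> R[i]) (tau : R) :
    set (nat -> R[i]) :=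
  [set x | exists u : R -> 'cV[R[i]]_nu,
    [/\ forall j, measurable_fun `[0, tau] (fun s => complex.Re (u s j 0)),
        forall j, measurable_fun `[0, tau] (fun s => complex.Im (u s j 0)),
        (\int[lebesgue_measure]_(s in `[0%R, tau]) (sqnorm (u s))%:E < +oo)%E &
        forall i : nat,
          x i = cintegral `[0, tau] (fun s => S (tau - s) (B (u s)) i)]].

Definition exactly_controllable A nu (B : 'cV[R[i]]_nu -> nat -> R[i]) : Prop :=
  exists S, generates A S /\
    exists tau : R, 0 < tau /\ forall x, l2 x -> reachable S B tau x.

Definition exactly_observable ny (C : (nat -> R[i]) -> 'cV[R[i]]_ny) A : Prop :=
  exists S, generates A S /\
    exists tau k : R, [/\ 0 < tau, 0 < k &
      forall x, l2 x ->
        k * l2sq x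
          <= (\int[lebesgue_measure]_(t in `[0%R, tau]) sqnorm (C (S t x)))%R].

(* With finitely many bounded inputs and outputs and eigenvalues whose real
   parts tend to -oo, the exact notions above cannot hold on the whole of
   l^2(N); the approximate ones are implied by them and can hold. *)
Definition approximately_controllable A nu
    (B : 'cV[R[i]]_nu -> nat -> R[i]) : Prop :=
  exists S, generates A S /\
    exists tau : R, 0 < tau /\ forall x, l2 x -> forall eps : R, 0 < eps ->
      exists y, [/\ l2 y, reachable S B tau y & l2sq (fun i => x i - y i) < eps].

Definition approximately_observable ny
    (C : (nat -> R[i]) -> 'cV[R[i]]_ny) A : Prop :=
  exists S, generates A S /\
    exists tau : R, 0 < tau /\ forall x, l2 x ->
      (forall t, t \in `[0, tau] -> C (S t x) = 0) -> x = (fun=> 0).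

End Operators.

(* Matrices of a decomposed form whose finite-dimensional part has dimension
   n0 + m. *)
Record modal_data (R : realType) (nu ny n0 m : nat) := ModalData {
  mA0 : 'M[R[i]]_n0;
  mA1 : 'M[R[i]]_m;
  ma : nat -> R[i];
  mB0 : 'M[R[i]]_(n0, nu);
  mB1 : 'M[R[i]]_(m, nu);
  mb : nat -> 'rV[R[i]]_nu;
  mC0 : 'M[R[i]]_(ny, n0);
  mC1 : 'M[R[i]]_(ny, m);
  mc : nat -> 'cV[R[i]]_ny }.

Section Modal.
Variables (R : realType) (nu ny n0 m : nat).
Implicit Type D : modal_data R nu ny n0 m.

Definition mA D : 'M[R[i]]_(n0 + m) := block_mx (mA0 D) 0 0 (mA1 D).
Definition mB D : 'M[R[i]]_(n0 + m, nu) := col_mx (mB0 D) (mB1 D).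
Definition mC D : 'M[R[i]]_(ny, n0 + m) := row_mx (mC0 D) (mC1 D).

Definition modal_output D (x : 'cV[R[i]]_(n0 + m)) (z : nat -> R[i]) :
    'cV[R[i]]_ny :=
  mC D *m x + \col_(j < ny) csum (fun i => mc D i j 0 * z i).

(* [Phi] is the change of variable from l^2(N) to C^(n0 + m) * l^2(N); only its
   values on l^2(N) matter. *)
Record conjugates (A : operator R) (B : 'cV[R[i]]_nu -> nat -> R[i])
    (C : (nat -> R[i]) -> 'cV[R[i]]_ny) D
    (Phi : (nat -> R[i]) -> 'cV[R[i]]_(n0 + m) * (nat -> R[i])) : Prop := {
  Phi_linear : forall (s : R[i]) x y, l2 x -> l2 y ->
    Phi (fun i => s * x i + y i) =
    (s *: (Phi x).1 + (Phi y).1, fun i => s * (Phi x).2 i + (Phi y).2 i);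
  Phi_bij : set_bij [set x | l2 x] [set p | l2 p.2] Phi;
  Phi_continuous : exists M : R, forall x, l2 x ->
    sqnorm (Phi x).1 + l2sq (Phi x).2 <= M * l2sq x;
  Phi_inv_continuous : exists M : R, forall x, l2 x ->
    l2sq x <= M * (sqnorm (Phi x).1 + l2sq (Phi x).2);
  Phi_dom : forall x, l2 x ->
    (dom A x <-> l2 (fun i => ma D i * (Phi x).2 i));
  Phi_A : forall x, dom A x ->
    Phi (act A x) = (mA D *m (Phi x).1, fun i => ma D i * (Phi x).2 i);
  Phi_B : forall u, Phi (B u) = (mB D *m u, fun i => (mb D i *m u) 0 0);
  Phi_C : forall x, l2 x -> C x = modal_output D (Phi x).1 (Phi x).2 }.

Record decomposed_form (delta : R) (A : operator R)
    (B : 'cV[R[i]]_nu -> nat -> R[i]) (C : (nat -> R[i]) -> 'cV[R[i]]_ny)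
    D : Prop := {
  decomposed_conjugates : exists Phi, conjugates A B C D Phi;
  decomposed_jordan0 : jordan (mA0 D);
  decomposed_jordan1 : jordan (mA1 D);
  decomposed_order_diag : forall i j : 'I_(n0 + m), (i <= j)%N ->
    complex.Re (mA D j j) <= complex.Re (mA D i i);
  decomposed_order_tail : forall i : nat,
    complex.Re (ma D i.+1) <= complex.Re (ma D i);
  decomposed_A1 : sigma_max (mA1 D) < - delta;
  decomposed_tail : forall i : nat, complex.Re (ma D i) < sigma_min (mA1 D) }.

Definition mF0 D (K0 : 'M[R[i]]_(nu, n0)) (G0 : 'M[R[i]]_(n0, ny)) :
    'M[R[i]]_(n0 + n0) :=
  block_mx (mA0 D + mB0 D *m K0) (- (G0 *m mC0 D))
           0                     (mA0 D + G0 *m mC0 D).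

Definition rho (delta : R) D (K0 : 'M[R[i]]_(nu, n0))
    (G0 : 'M[R[i]]_(n0, ny)) (P0 : 'M[R[i]]_(n0 + n0)) : R :=
  let G := col_mx (- G0) G0 in
  let beta := limn (series (fun i =>
    sigma_max (K0^t* *m (mb D i)^t* *m mb D i *m K0))) in
  let gamma := limn (series (fun i =>
    sigma_max ((mc D i)^t* *m G^t* *m P0 *m G *m mc D i))) in
  16 * beta * gamma /
  (delta ^+ 2 * sigma_min P0 *
   (`|sigma_min (mA1 D)| - delta) * `|sigma_min (mA1 D)|).

(* Solutions on [0, +oo[ of the decomposed system in closed loop with
   xh' = L xh + Mc y + N u, u = K xh. *)
Record closed_loop_solution D (q : nat) (L : 'M[R[i]]_q)
    (Mc : 'M[R[i]]_(q, ny)) (N : 'M[R[i]]_(q, nu)) (K : 'M[R[i]]_(nu, q))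
    (x : R -> 'cV[R[i]]_(n0 + m)) (z : R -> nat -> R[i])
    (xh : R -> 'cV[R[i]]_q) : Prop := {
  sol_l2 : forall t, 0 <= t -> l2 (z t);
  sol_x_cont : forall k, ccontinuous_within `[0, +oo[ (fun t => x t k 0);
  sol_z_cont : forall i, ccontinuous_within `[0, +oo[ (fun t => z t i);
  sol_xh_cont : forall k, ccontinuous_within `[0, +oo[ (fun t => xh t k 0);
  sol_x : forall t, 0 < t -> forall k,
    has_cderive (fun s => x s k 0) t
      ((mA D *m x t + mB D *m (K *m xh t)) k 0);
  sol_z : forall t, 0 < t -> forall i,
    has_cderive (fun s => z s i) t
      (ma D i * z t i + (mb D i *m (K *m xh t)) 0 0);
  sol_xh : forall t, 0 < t -> forall k,
    has_cderive (fun s => xh s k 0) t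
      ((L *m xh t + Mc *m modal_output D (x t) (z t)
        + N *m (K *m xh t)) k 0) }.

Definition exponentially_stable (delta : R) D (q : nat) (L : 'M[R[i]]_q)
    (Mc : 'M[R[i]]_(q, ny)) (N : 'M[R[i]]_(q, nu)) (K : 'M[R[i]]_(nu, q)) :
    Prop :=
  exists kappa : R, 1 <= kappa /\
    forall x z xh, closed_loop_solution D L Mc N K x z xh ->
      forall t : R, 0 <= t ->
        sqnorm (x t) + l2sq (z t) + sqnorm (xh t)
          <= kappa * expR (- delta * t)
             * (sqnorm (x 0) + l2sq (z 0) + sqnorm (xh 0)).

End Modal.

(* Main.v *)
Require Import Defs.
From mathcomp Require Import all_boot all_order all_algebra.
From mathcomp Require Import spectral sesquilinear.
From mathcomp.real_closed Require Import complex.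
From mathcomp Require Import all_classical all_reals all_analysis.
From mathcomp Require Import ring lra.

Import Order.TTheory GRing.Theory Num.Theory.
Import numFieldNormedType.Exports.

Local Open Scope classical_set_scope.
Local Open Scope complex_scope.
Local Open Scope sesquilinear_scope.
Local Open Scope ring_scope.

(** Why the loop is stable.  In the coordinates w = (xh0, x0 - xh0) (observed
    slow state and its estimation error) and e = x1 - xh1, the closed loop reads
[[
      w'   = F0 w + G (C1 e + zeta),   G = [-G0; G0],   zeta = sum_i c_i z_i,
      z_i' = a_i z_i + b_i K0 xh0,
      e'   = A1 e,
      xh1' = A1 xh1 + B1 K0 xh0.
]]
    The error e is autonomous and xh1 is only driven, so apart from these two
    exponentially decaying signals what remains is a feedback interconnection
    of w and the infinite tail z.

    Factor P0 = S^* S, so that the Lyapunov function of the matrix inequality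
    is |S w|^2.  A single estimate, [energy_decay], serves every block: if the
    unforced motion of y loses energy at a rate strictly faster than
    exp (- delta t), and the forcing satisfies |f|^2 <= F exp (- delta t), then
    |y|^2 is bounded by (|y(0)|^2 + F / th^2) exp (- delta t), where th is the
    margin of the rate over delta / 2.  It is applied to S w (margin
    delta / 2), to each z_i separately (margin s - delta / 2, with
    s = |sigma_min A1|), and to the components of a triangular system solved by
    back substitution ([triangular_decay]).

    No regularity of t |-> z(t) in l2 is available, only that of the
    components; hence the tail is estimated componentwise and the squared
    bounds are summed afterwards ([tail_l2sq_le]).  The loop is closed by a
    small-gain argument without any integration ([small_gain_stable]).  On
    [0, T] let Q be the maximum of exp (delta t) |S w(t)|^2, which is finite by
    continuity.  Then |xh0|^2 <= (Q / p) exp (- delta t), with p = sigma_min P0,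
    which bounds z, hence zeta, hence S w, and one gets
[[
      Q <= (initial data) + (8 beta gamma / (delta^2 p (s - delta / 2)^2)) Q.
]]
    As (s - delta) s <= (s - delta / 2)^2, the hypothesis on rho makes the
    factor at most 1/2, so Q is bounded by the initial data independently
    of T.

    The two series in rho must be shown to converge: the changes of variable
    being bounded, the sequences b_i u and the rows of the c_i are square
    summable ([tail_input_l2], [tail_output_l2]), and spectral theory of
    Hermitian matrices compares sigma_min and sigma_max with quadratic forms
    ([rayleigh_bounds]). *)

(** * Real inner product on complex vectors *)

Section HermitianForms.
Context {R : realType}.
Implicit Types (a b w : R[i]).

(** Re (u^* v) rather than the Hermitian product: half of the derivative of
    |y|^2 along y' = d is Re (y^* d). *)
Definition rdot {n} (u v : 'cV[R[i]]_n) : R := complex.Re ((u^t* *m v) 0 0).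

Lemma cReD a b : complex.Re (a + b) = complex.Re a + complex.Re b.
Proof. by case: a b => [? ?] [? ?]. Qed.

Lemma cImD a b : complex.Im (a + b) = complex.Im a + complex.Im b.
Proof. by case: a b => [? ?] [? ?]. Qed.

Lemma cReM a b :
  complex.Re (a * b) = complex.Re a * complex.Re b - complex.Im a * complex.Im b.
Proof. by case: a b => [? ?] [? ?]. Qed.

Lemma cImM a b :
  complex.Im (a * b) = complex.Re a * complex.Im b + complex.Im a * complex.Re b.
Proof. by case: a b => [? ?] [? ?]. Qed.

Lemma cRe_sum I (r : seq I) (P : pred I) (F : I -> R[i]) :
  complex.Re (\sum_(i <- r | P i) F i) = \sum_(i <- r | P i) complex.Re (F i).
Proof. exact: (big_morph (@complex.Re R) cReD (erefl _)). Qed.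

Lemma cIm_sum I (r : seq I) (P : pred I) (F : I -> R[i]) :
  complex.Im (\sum_(i <- r | P i) F i) = \sum_(i <- r | P i) complex.Im (F i).
Proof. exact: (big_morph (@complex.Im R) cImD (erefl _)). Qed.

Lemma cRe_conj w : complex.Re (Num.conj w) = complex.Re w.
Proof. by case: w. Qed.

Lemma cIm_conj w : complex.Im (Num.conj w) = - complex.Im w.
Proof. by case: w. Qed.

Lemma sqmod_ge0 w : 0 <= sqmod w.
Proof. by rewrite addr_ge0 // sqr_ge0. Qed.

Lemma sqmodM a b : sqmod (a * b) = sqmod a * sqmod b.
Proof. rewrite /sqmod cReM cImM; ring. Qed.

Lemma sqmod_conj w : sqmod (Num.conj w) = sqmod w.
Proof. by rewrite /sqmod cRe_conj cIm_conj sqrrN. Qed.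

Lemma sqmod0 : sqmod (0 : R[i]) = 0.
Proof. by rewrite /sqmod /= expr0n addr0. Qed.

Lemma conj_mul_sqmod w : Num.conj w * w = (sqmod w)%:C.
Proof. by case: w => x y; apply/eqP; rewrite eq_complex /sqmod /=; apply/andP; split; apply/eqP; ring. Qed.

Lemma sqmodD_le a b : sqmod (a + b) <= 2 * sqmod a + 2 * sqmod b.
Proof.
rewrite /sqmod cReD cImD.
have := sqr_ge0 (complex.Re a - complex.Re b).
have := sqr_ge0 (complex.Im a - complex.Im b).
nra.
Qed.

Lemma rdotE n (u v : 'cV[R[i]]_n) : rdot u v =
  \sum_(k < n) (complex.Re (u k 0) * complex.Re (v k 0)
                + complex.Im (u k 0) * complex.Im (v k 0)).
Proof.
rewrite /rdot mxE cRe_sum; apply: eq_bigr => k _.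
by rewrite !mxE cReM cRe_conj cIm_conj mulNr opprK.
Qed.

Lemma rdotvv n (u : 'cV[R[i]]_n) : rdot u u = sqnorm u.
Proof. by rewrite rdotE; apply: eq_bigr => k _; rewrite -!expr2. Qed.

Lemma rdotC n (u v : 'cV[R[i]]_n) : rdot u v = rdot v u.
Proof.
rewrite !rdotE; apply: eq_bigr => k _.
by rewrite mulrC [X in _ + X]mulrC.
Qed.

Lemma rdotDr n (u v w : 'cV[R[i]]_n) : rdot u (v + w) = rdot u v + rdot u w.
Proof. by rewrite /rdot mulmxDr mxE cReD. Qed.

Lemma rdotNr n (u v : 'cV[R[i]]_n) : rdot u (- v) = - rdot u v.
Proof. by rewrite /rdot mulmxN mxE; case: ((_ *m _) 0 0). Qed.

Lemma rdotZr n (k : R) (u v : 'cV[R[i]]_n) : rdot u (k%:C *: v) = k * rdot u v.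
Proof. by rewrite /rdot -scalemxAr mxE cReM /= mul0r subr0. Qed.

Lemma rdot_mull m n (M : 'M[R[i]]_(m, n)) (u : 'cV[R[i]]_n) (v : 'cV[R[i]]_m) :
  rdot (M *m u) v = rdot u (M^t* *m v).
Proof. by rewrite /rdot trmx_mul map_mxM mulmxA. Qed.

(** The matrix of the Lyapunov inequality for P = S^* S is the derivative of
    |S u|^2 along u' = F u, so the inequality says that |S u|^2 is dissipated. *)
Lemma gram_lyapunov n (S F : 'M[R[i]]_n) (u : 'cV[R[i]]_n) :
  rdot u ((S^t* *m S *m F + F^t* *m (S^t* *m S)) *m u)
    = 2 * rdot (S *m u) (S *m (F *m u)).
Proof.
rewrite mulmxDl rdotDr -!mulmxA -!rdot_mull [X in _ + X]rdotC; ring.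
Qed.

Lemma sqnorm_ge0 n (u : 'cV[R[i]]_n) : 0 <= sqnorm u.
Proof. by apply: sumr_ge0 => k _; apply: sqmod_ge0. Qed.

Lemma sqmod_le_sqnorm n (u : 'cV[R[i]]_n) k : sqmod (u k 0) <= sqnorm u.
Proof.
by rewrite /sqnorm (bigD1 k) //= lerDl; apply: sumr_ge0 => j _; apply: sqmod_ge0.
Qed.

Lemma sqnormN n (u : 'cV[R[i]]_n) : sqnorm (- u) = sqnorm u.
Proof.
apply: eq_bigr => k _; rewrite mxE /sqmod.
by case: (u k 0) => x y /=; rewrite !sqrrN.
Qed.

Lemma sqnormD_le n (u v : 'cV[R[i]]_n) :
  sqnorm (u + v) <= 2 * sqnorm u + 2 * sqnorm v.
Proof.
rewrite /sqnorm !mulr_sumr -big_split /=; apply: ler_sum => k _.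
by rewrite mxE sqmodD_le.
Qed.

Lemma sqnorm_col_mx m n (u : 'cV[R[i]]_m) (v : 'cV[R[i]]_n) :
  sqnorm (col_mx u v) = sqnorm u + sqnorm v.
Proof.
rewrite /sqnorm big_split_ord /=; congr (_ + _); apply: eq_bigr => k _.
  by rewrite col_mxEu.
by rewrite col_mxEd.
Qed.

(** Expand 0 <= |th u - v|^2 / th. *)
Lemma rdot_young n (u v : 'cV[R[i]]_n) (th : R) : 0 < th ->
  2 * rdot u v <= th * sqnorm u + th^-1 * sqnorm v.
Proof.
move=> th0; rewrite rdotE /sqnorm !mulr_sumr -big_split /=.
have young (x y : R) : 2 * (x * y) <= th * x ^+ 2 + th^-1 * y ^+ 2.
  rewrite -subr_ge0.
  have -> : th * x ^+ 2 + th^-1 * y ^+ 2 - 2 * (x * y)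
            = th^-1 * (th * x - y) ^+ 2 by field; rewrite gt_eqF.
  by rewrite mulr_ge0 ?sqr_ge0 // invr_ge0 ltW.
apply: ler_sum => k _; rewrite /sqmod !mulrDr.
by rewrite addrACA lerD.
Qed.

(** By induction on the sequence.  The cross term 2 Re (conj(ab) s) is at most
    2 sqrt (A B F G), hence at most A G + F B, where A = |a|^2, B = |b|^2, and F
    and G are the two sums of squares over the tail. *)
Lemma cauchy_schwarz I (r : seq I) (f g : I -> R[i]) :
  sqmod (\sum_(i <- r) f i * g i)
    <= (\sum_(i <- r) sqmod (f i)) * (\sum_(i <- r) sqmod (g i)).
Proof.
elim: r => [|i r IH]; first by rewrite !big_nil sqmod0 mul0r.
rewrite !big_cons.
have F0 : 0 <= \sum_(j <- r) sqmod (f j) by apply: sumr_ge0 => *; apply: sqmod_ge0.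
have G0 : 0 <= \sum_(j <- r) sqmod (g j) by apply: sumr_ge0 => *; apply: sqmod_ge0.
move: F0 G0 IH; set F := \sum_(j <- r) sqmod (f j); set G := \sum_(j <- r) sqmod (g j).
set s := \sum_(j <- r) _ => F0 G0 IH.
move: (f i) (g i) => a b.
pose p := a * b.
pose X := complex.Re p * complex.Re s + complex.Im p * complex.Im s.
have -> : sqmod (a * b + s) = sqmod a * sqmod b + 2 * X + sqmod s.
  by rewrite -sqmodM -/p /X /sqmod cReD cImD; ring.
have X2 : X ^+ 2 <= sqmod a * sqmod b * sqmod s.
  rewrite -sqmodM -/p /X /sqmod -subr_ge0.
  set d := _ - _; suff -> : d =
    (complex.Re p * complex.Im s - complex.Im p * complex.Re s) ^+ 2.
    exact: sqr_ge0.
  by rewrite /d; ring.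
move: (sqmod_ge0 a) (sqmod_ge0 b) (sqmod_ge0 s) X2 IH.
move: (sqmod a) (sqmod b) (sqmod s) X => A B S X A0 B0 S0 X2 IH.
suff h : 2 * X <= A * G + F * B by rewrite mulrDl !mulrDr; lra.
have N0 : 0 <= A * G + F * B by rewrite addr_ge0 ?mulr_ge0.
have [X0|X0] := ltP X 0; first by apply: le_trans N0; rewrite pmulr_rle0 // ltW.
rewrite -ler_sqr ?nnegrE ?mulr_ge0 //.
have h : X ^+ 2 <= A * B * (F * G) by apply: (le_trans X2); rewrite ler_wpM2l // mulr_ge0.
have := sqr_ge0 (A * G - F * B); nra.
Qed.

Definition sqfrob {m n} (M : 'M[R[i]]_(m, n)) : R :=
  \sum_(i < m) \sum_(j < n) sqmod (M i j).

Lemma sqfrob_ge0 m n (M : 'M[R[i]]_(m, n)) : 0 <= sqfrob M.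
Proof. by apply: sumr_ge0 => i _; apply: sumr_ge0 => j _; apply: sqmod_ge0. Qed.

Lemma sqnorm_mulmx_le m n (M : 'M[R[i]]_(m, n)) (v : 'cV[R[i]]_n) :
  sqnorm (M *m v) <= sqfrob M * sqnorm v.
Proof.
rewrite /sqnorm /sqfrob mulr_suml; apply: ler_sum => i _.
by rewrite mxE; apply: cauchy_schwarz.
Qed.

End HermitianForms.

(** * Extreme real parts of eigenvalues and quadratic forms *)

Section Spectrum.
Context {R : realType}.

(** The eigenvalues are the roots of the characteristic polynomial, which
    splits over R[i]. Finiteness turns the sup and inf of [sigma_max] and
    [sigma_min] into a maximum and a minimum. *)
Lemma finite_spectrum n (M : 'M[R[i]]_n) :
  exists r : seq R[i], forall a, eigenvalue M a = (a \in r).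
Proof.
have [r Er] := closed_field_poly_normal (char_poly M).
exists r => a; rewrite eigenvalue_root_char Er (monicP (char_poly_monic M)).
by rewrite scale1r root_prod_XsubC.
Qed.

Lemma spectrum_has_bounds n (M : 'M[R[i]]_n) :
  has_lbound [set complex.Re a | a in [set a | eigenvalue M a]] /\
  has_ubound [set complex.Re a | a in [set a | eigenvalue M a]].
Proof.
have [r Er] := finite_spectrum n M.
have bnd a : eigenvalue M a -> `|complex.Re a| <= \sum_(z <- r) `|complex.Re z|.
  rewrite Er => ar; rewrite (big_rem a) //= lerDl.
  by apply: sumr_ge0 => *; apply: normr_ge0.
split; [exists (- \sum_(z <- r) `|complex.Re z|) | exists (\sum_(z <- r) `|complex.Re z|)];
  move=> _ [a /bnd h <-]; move: h; rewrite ler_norml => /andP[] //.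
Qed.

Lemma sigma_min_le n (M : 'M[R[i]]_n) a : eigenvalue M a -> sigma_min M <= complex.Re a.
Proof. by move=> ea; apply: ge_inf; [apply: (spectrum_has_bounds n M).1 | exists a]. Qed.

Lemma le_sigma_max n (M : 'M[R[i]]_n) a : eigenvalue M a -> complex.Re a <= sigma_max M.
Proof. by move=> ea; apply: ub_le_sup; [apply: (spectrum_has_bounds n M).2 | exists a]. Qed.

Lemma sigma_min_attained n (M : 'M[R[i]]_n) : (0 < n)%N ->
  exists2 a, eigenvalue M a & sigma_min M = complex.Re a.
Proof.
move=> n0; have [a0 ea0] := eigenvalue_closed M n0.
have [r Er] := finite_spectrum n M.
have i0 : (index a0 r < size r)%N by rewrite index_mem -Er.
case: (@Order.TotalTheory.arg_minP _ _ _ (Ordinal i0) xpredT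
  (fun i : 'I_(size r) => complex.Re (r`_i)) isT) => i _ min_i.
have ei : eigenvalue M r`_i by rewrite Er mem_nth.
exists r`_i => //; apply: le_anti; rewrite sigma_min_le //=.
apply: lb_le_inf; first by exists (complex.Re r`_i), r`_i.
move=> _ [a /= ea <-]; rewrite Er in ea.
have ia : (index a r < size r)%N by rewrite index_mem.
by have := min_i (Ordinal ia) isT; rewrite /= nth_index.
Qed.

Lemma row_quadratic n (v : 'rV[R[i]]_n) : (v *m v^t*) 0 0 = (sqnorm (v^t*))%:C.
Proof.
rewrite mxE (big_morph (fun x : R => x%:C) (raddfD _) (erefl _)).
by apply: eq_bigr => k _; rewrite !mxE mulrC conj_mul_sqmod sqmod_conj.
Qed.

Lemma sqnorm_eq0 n (v : 'cV[R[i]]_n) : sqnorm v = 0 -> v = 0.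
Proof.
move=> v0; apply/colP => k; rewrite mxE.
have : sqmod (v k 0) <= 0 by rewrite -v0 sqmod_le_sqnorm.
rewrite /sqmod; case: (v k 0) => x y /= h; apply/eqP; rewrite eq_complex /=.
have := sqr_ge0 x; have := sqr_ge0 y => y0 x0.
by rewrite -(sqrf_eq0 x) -(sqrf_eq0 y); apply/andP; split; apply/eqP; lra.
Qed.

Lemma sqnorm_dim0 n (v : 'cV[R[i]]_n) : n = 0%N -> sqnorm v = 0.
Proof. by move=> n0; subst n; rewrite /sqnorm big_ord0. Qed.

(** Eigenvalues are defined through row vectors; the conjugate transpose of
    an eigenrow is a column vector on which the quadratic form is the eigenvalue
    times the squared norm. *)
Lemma eigenvalue_row n (M : 'M[R[i]]_n) a : eigenvalue M a ->
  exists2 v : 'cV[R[i]]_n, v != 0 & v^t* *m M *m v = (a * (sqnorm v)%:C)%:M.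
Proof.
case/eigenvalueP => v vM v0; exists (v^t*).
  apply: contraNneq v0 => h; rewrite -(trmxCK v) h.
  by rewrite trmx0 map_mx0.
rewrite trmxCK vM -scalemxAl [v *m _]mx11_scalar row_quadratic.
by rewrite scale_scalar_mx.
Qed.

Lemma posdef_sigma_min_gt0 n (M : 'M[R[i]]_n) : (0 < n)%N -> posdef M ->
  0 < sigma_min M.
Proof.
move=> n0 [_ pM]; have [a ea ->] := sigma_min_attained n M n0.
have [v v0 Ev] := eigenvalue_row n M a ea.
have := pM v v0; rewrite Ev mxE mulr1n ltcE => /andP[_].
rewrite cReM /= mulr0 subr0 => h.
by apply: contraTT h; rewrite -!leNgt => h; rewrite mulr_le0_ge0 // sqnorm_ge0.
Qed.

Lemma sigma_max0 (M : 'M[R[i]]_0) : sigma_max M = 0.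
Proof.
rewrite /sigma_max; set E := (X in sup X).
suff -> : E = set0 by rewrite sup0.
apply/seteqP; split=> // _ [a /= /eigenvalueP[v _ v0] _].
have v00 : v = 0 by apply/rowP => -[].
by rewrite v00 eqxx in v0.
Qed.

Lemma sigma_max_dim0 n (M : 'M[R[i]]_n) : n = 0%N -> sigma_max M = 0.
Proof. by move=> n0; subst n; apply: sigma_max0. Qed.

(** An eigenvalue a of T^* T satisfies a |v|^2 = |T v|^2, and the Frobenius
    norm dominates the operator norm. *)
Lemma sigma_max_gram_le m n (T : 'M[R[i]]_(m, n)) :
  sigma_max (T^t* *m T) <= sqfrob T.
Proof.
case: n T => [|n] T.
  by rewrite sigma_max0 sqfrob_ge0.
apply: ge_sup.
  have [a ea] := eigenvalue_closed (T^t* *m T) (ltn0Sn n).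
  by exists (complex.Re a), a.
move=> _ [a /= /eigenvalue_row[v v0 Ev] <-].
have vpos : 0 < sqnorm v.
  by rewrite lt_def sqnorm_ge0 andbT; apply: contra_neq v0; apply: sqnorm_eq0.
rewrite -(ler_pM2r vpos).
have <- : sqnorm (T *m v) = complex.Re a * sqnorm v; last exact: sqnorm_mulmx_le.
rewrite -rdotvv /rdot trmx_mul map_mxM mulmxA -(mulmxA _ _ T) Ev mxE mulr1n.
by rewrite cReM /= mulr0 subr0.
Qed.

Lemma sigma_max_mx11 (M : 'M[R[i]]_1) : sigma_max M = complex.Re (M 0 0).
Proof.
rewrite /sigma_max; set E := (X in sup X).
suff -> : E = [set complex.Re (M 0 0)] by rewrite sup1.
have eM : eigenvalue M (M 0 0).
  apply/eigenvalueP; exists 1%:M; last exact: oner_neq0.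
  by rewrite mul1mx scalemx1; exact: mx11_scalar.
apply/seteqP; split=> [_ [a /= /eigenvalueP[v vM v0] <-] | _ ->]; last by exists (M 0 0).
suff -> : a = M 0 0 by [].
have v00 : v 0 0 != 0.
  by apply: contra_neq v0 => h; rewrite [v]mx11_scalar h; apply/matrixP => i j; rewrite !mxE mul0rn.
have := congr1 (fun X : 'rV[R[i]]_1 => X 0 0) vM.
rewrite !mxE big_ord1 [RHS]mulrC => /(mulfI v00); exact: esym.
Qed.

Section Hermitian.
Context {n : nat} (M : 'M[R[i]]_n) (hM : M \is hermsymmx).
Let U := spectralmx M.
Let d := spectral_diag M.

Lemma spectral_decomposition : M = U^t* *m diag_mx d *m U.
Proof.
rewrite -invmx_unitary ?spectral_unitarymx //.
by apply/orthomx_spectralP/hermitian_normalmx.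
Qed.

Lemma spectral_diag_eigenvalue k : eigenvalue M (d 0 k).
Proof.
have uU : U \in unitmx by apply: spectral_unit.
apply/eigenvalueP; exists (row k U).
  rewrite -row_mul [M]spectral_decomposition -invmx_unitary ?spectral_unitarymx //.
  rewrite !mulmxA mulmxV // mul1mx; apply/rowP => j.
  by rewrite mul_diag_mx !mxE.
apply/eqP => /(congr1 (mulmx^~ (invmx U))).
rewrite -row_mul mulmxV // mul0mx row1 => /rowP/(_ k).
by rewrite !mxE !eqxx => /eqP; rewrite oner_eq0.
Qed.

Lemma spectral_diag_real k : (complex.Re (d 0 k))%:C = d 0 k.
Proof. by apply: RRe_real; apply: (mxOverP (hermitian_spectral_diag_real hM)). Qed.

Lemma sqnorm_spectralmx (v : 'cV[R[i]]_n) : sqnorm (U *m v) = sqnorm v.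
Proof.
rewrite -!rdotvv rdot_mull mulmxA -invmx_unitary ?spectral_unitarymx //.
by rewrite mulVmx ?spectral_unit // mul1mx.
Qed.

Lemma quadratic_spectral (v : 'cV[R[i]]_n) :
  rdot v (M *m v) = \sum_k complex.Re (d 0 k) * sqmod ((U *m v) k 0).
Proof.
rewrite [in LHS]spectral_decomposition -!mulmxA -[U^t*]trmxCK -rdot_mull.
rewrite !trmxCK rdotE; apply: eq_bigr => k _.
rewrite mul_diag_mx [X in _ * complex.Re X]mxE [X in _ * complex.Im X]mxE.
rewrite -[d 0 k]spectral_diag_real /sqmod cReM cImM /=; ring.
Qed.

(** In the coordinates U v the form is a sum of squares weighted by the
    spectrum, and U is an isometry. *)
Lemma rayleigh_bounds (v : 'cV[R[i]]_n) :
  sigma_min M * sqnorm v <= rdot v (M *m v) <= sigma_max M * sqnorm v.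
Proof.
rewrite quadratic_spectral -(sqnorm_spectralmx v) /sqnorm !mulr_sumr.
apply/andP; split; apply: ler_sum => k _; apply: ler_wpM2r; rewrite ?sqmod_ge0 //.
  exact/sigma_min_le/spectral_diag_eigenvalue.
exact/le_sigma_max/spectral_diag_eigenvalue.
Qed.

(** S = D^(1/2) U, with U^* D U the spectral decomposition. *)
Lemma psd_factor : (forall v : 'cV[R[i]]_n, 0 <= rdot v (M *m v)) ->
  exists S : 'M[R[i]]_n, M = S^t* *m S.
Proof.
move=> psd.
have d_ge0 k : 0 <= complex.Re (d 0 k).
  have [v v0 Ev] := eigenvalue_row _ _ _ (spectral_diag_eigenvalue k).
  have := psd v; rewrite /rdot mulmxA Ev mxE mulr1n cReM /= mulr0 subr0.
  rewrite pmulr_lge0 // lt_def sqnorm_ge0 andbT.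
  by apply: contra_neq v0; apply: sqnorm_eq0.
pose r : 'rV[R[i]]_n := \row_k (Num.sqrt (complex.Re (d 0 k)))%:C.
exists (diag_mx r *m U).
rewrite trmx_mul map_mxM -mulmxA (mulmxA _ (diag_mx r)) [LHS]spectral_decomposition -mulmxA.
congr (_ *m (_ *m _)); rewrite tr_diag_mx map_diag_mx mulmx_diag; congr diag_mx.
apply/rowP => k; rewrite !mxE -[LHS]spectral_diag_real.
rewrite conj_mul_sqmod /sqmod /= expr0n addr0 sqr_sqrtr //.
Qed.

End Hermitian.

Lemma gram_hermitian m n (T : 'M[R[i]]_(m, n)) : T^t* *m T \is hermsymmx.
Proof.
apply/is_hermitianmxP; rewrite expr0 scale1r.
by rewrite trmx_mul map_mxM trmxCK.
Qed.

Lemma sqnorm_le_sigma_max_gram m n (T : 'M[R[i]]_(m, n)) (v : 'cV[R[i]]_n) :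
  sqnorm (T *m v) <= sigma_max (T^t* *m T) * sqnorm v.
Proof.
rewrite -rdotvv rdot_mull mulmxA.
by case/andP: (rayleigh_bounds _ (gram_hermitian _ _ T) v).
Qed.

(** Test the Rayleigh bound on the vector of ones. *)
Lemma sigma_max_gram_ge0 m n (T : 'M[R[i]]_(m, n)) : 0 <= sigma_max (T^t* *m T).
Proof.
case: n T => [|n] T; first by rewrite sigma_max0.
pose v : 'cV[R[i]]_n.+1 := const_mx 1.
have v0 : 0 < sqnorm v.
  rewrite lt_def sqnorm_ge0 andbT; apply/eqP => /sqnorm_eq0/colP/(_ 0).
  by rewrite !mxE => /eqP; rewrite oner_eq0.
rewrite -(pmulr_lge0 _ v0); apply: le_trans (sqnorm_le_sigma_max_gram _ _ T v).
exact: sqnorm_ge0.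
Qed.

Lemma posdef_rdot_ge0 n (M : 'M[R[i]]_n) (v : 'cV[R[i]]_n) :
  posdef M -> 0 <= rdot v (M *m v).
Proof.
move=> [_ pM]; have [->|v0] := eqVneq v 0.
  by rewrite mulmx0 /rdot mulmx0 mxE.
by have := pM v v0; rewrite ltcE -mulmxA => /andP[_ /ltW].
Qed.

(** Jordan blocks are upper triangular while [char_poly_trig] speaks of lower
    triangular matrices, hence the transposes. *)
Lemma is_trig_eigenvalue n (M : 'M[R[i]]_n) k : is_trig_mx M^T -> eigenvalue M (M k k).
Proof.
move=> tM; rewrite eigenvalue_root_char.
have -> : char_poly M = char_poly M^T.
  rewrite /char_poly -det_tr; congr (\det _); apply/matrixP => i j.
  by rewrite !mxE eq_sym.
rewrite char_poly_trig // -(big_map (fun i => M^T i i) xpredT (fun a => 'X - a%:P)).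
rewrite root_prod_XsubC; apply/mapP; exists k; rewrite ?mem_index_enum //.
by rewrite mxE.
Qed.

Lemma jordan_trig n (M : 'M[R[i]]_n) : jordan M -> is_trig_mx M^T.
Proof.
move=> jM; apply/is_trig_mxP => i j ij; rewrite mxE.
have [h _] := jM j i; apply: h; first by rewrite neq_ltn ij.
by rewrite ltn_eqF // ltnS ltnW.
Qed.

End Spectrum.

(** * Trajectories and decay of their energy *)

Section Calculus.
Context {R : realType}.

Lemma is_derive_addf (f g : R -> R) (t df dg : R) :
  is_derive t 1 f df -> is_derive t 1 g dg ->
  is_derive t 1 (fun s => f s + g s) (df + dg).
Proof. exact: is_deriveD. Qed.

Lemma is_derive_mulf (f g : R -> R) (t df dg : R) :
  is_derive t 1 f df -> is_derive t 1 g dg ->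
  is_derive t 1 (fun s => f s * g s) (f t * dg + g t * df).
Proof. exact: is_deriveM. Qed.

Lemma is_derive_scalef (k : R) (f : R -> R) (t df : R) :
  is_derive t 1 f df -> is_derive t 1 (fun s => k * f s) (k * df).
Proof. exact: is_deriveZ. Qed.

Lemma is_derive_sumf n (f : 'I_n -> R -> R) (df : 'I_n -> R) (t : R) :
  (forall k, is_derive t 1 (f k) (df k)) ->
  is_derive t 1 (fun s => \sum_k f k s) (\sum_k df k).
Proof.
move=> h; have := is_derive_sum h.
by rewrite (_ : \sum_k f k = (fun s => \sum_k f k s)) // fct_sumE.
Qed.

Lemma is_derive_exp_scale (c t : R) :
  is_derive t 1 (fun s => expR (c * s)) (c * expR (c * t)).
Proof.
rewrite mulrC; apply: (@is_derive1_comp R expR (fun s => c * s)).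
rewrite -[X in is_derive _ _ _ X]mulr1.
exact: (is_derive_scalef c (fun s => s)).
Qed.

Context {D : set R}.

Lemma within_continuous_add (f g : R -> R) :
  {within D, continuous f} -> {within D, continuous g} ->
  {within D, continuous (fun s => f s + g s)}.
Proof. by move=> cf cg x; apply: cvgD; [apply: cf | apply: cg]. Qed.

Lemma within_continuous_mul (f g : R -> R) :
  {within D, continuous f} -> {within D, continuous g} ->
  {within D, continuous (fun s => f s * g s)}.
Proof. by move=> cf cg x; apply: cvgM; [apply: cf | apply: cg]. Qed.

Lemma within_continuous_cst (k : R) : {within D, continuous (fun=> k)}.
Proof. by move=> x; apply: cvg_cst. Qed.

Lemma within_continuous_sum n (f : 'I_n -> R -> R) :
  (forall k, {within D, continuous (f k)}) ->
  {within D, continuous (fun s => \sum_k f k s)}.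
Proof.
elim: n f => [|n IH] f cf.
  rewrite (_ : (fun s => _) = fun=> 0);
    last by apply/funext => s; rewrite big_ord0.
  exact: within_continuous_cst.
rewrite (_ : (fun s => _) = fun s => f ord0 s + \sum_k f (lift ord0 k) s);
  last by apply/funext => s; rewrite big_ord_recl.
by apply: within_continuous_add => //; apply: IH.
Qed.

Lemma within_continuous_exp_scale (c : R) :
  {within D, continuous (fun s => expR (c * s))}.
Proof.
apply: continuous_subspaceT => x.
apply: (@continuous_comp _ _ _ (fun s => c * s) expR); last exact: continuous_expR.
by apply: cvgM; [apply: cvg_cst | apply: cvg_id].
Qed.

End Calculus.

Section DifferentialInequality.
Context {R : realType}.

(** The function exp (th t) (f t - H / th) is nonincreasing. *)
Lemma dissipation_bound (f df : R -> R) (T th H : R) :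
  {within `[0, T], continuous f} ->
  (forall t, 0 < t < T -> is_derive t 1 f (df t)) ->
  (forall t, 0 < t < T -> df t <= - th * f t + H) ->
  0 < th -> 0 <= H -> 0 <= f 0 ->
  forall t, 0 <= t <= T -> f t <= f 0 + H / th.
Proof.
move=> cf dff dfle th0 H0 f0 t /andP[t0 tT].
pose g s := expR (th * s) * (f s + - (H / th)).
have dg s : 0 < s < T ->
    is_derive s 1 g (expR (th * s) * (df s + 0)
                     + (f s + - (H / th)) * (th * expR (th * s))).
  move=> sT; apply: is_derive_mulf; first exact: is_derive_exp_scale.
  by apply: is_derive_addf; apply: dff.
have cg : {within `[0, T], continuous g}.
  apply: within_continuous_mul; first exact: within_continuous_exp_scale.
  by apply: within_continuous_add => //; apply: within_continuous_cst.
have gle : g t <= g 0.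
  apply: (@ler0_derive1_le_cc _ g 0 T) => //; rewrite ?in_itv /= ?t0 ?tT ?lexx //.
  - by move=> s; rewrite in_itv /= => /dg [].
  - move=> s; rewrite in_itv /= => sT; rewrite derive1E.
    have [_ ->] := dg s sT.
    set E := expR _; set v := _ + _.
    have -> : v = E * (df s + th * f s - th * (H / th)) by rewrite /v; ring.
    rewrite pmulr_rle0 ?expR_gt0 //.
    have -> : th * (H / th) = H by field; rewrite gt_eqF.
    by have := dfle s sT; rewrite mulNr; lra.
  - exact: le_trans tT.
rewrite /g mulr0 expR0 mul1r in gle.
have e1 : 1 <= expR (th * t).
  by rewrite -expR0 ler_expR mulr_ge0 // ltW.
have Hth : 0 <= H / th by rewrite divr_ge0 // ltW.
rewrite -subr_ge0.
have [|h] := leP (f t) (H / th); first by lra.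
have : 0 < f t - H / th by lra.
nra.
Qed.

End DifferentialInequality.

Section Trajectories.
Context {R : realType}.

(** The regularity granted to a solution: continuity up to time 0 and, for
    positive times only, the derivative. *)
Definition trajectory {n} (y d : R -> 'cV[R[i]]_n) : Prop :=
  (forall k, ccontinuous_within `[0, +oo[ (fun t => y t k 0)) /\
  (forall t, 0 < t -> forall k, has_cderive (fun s => y s k 0) t (d t k 0)).

Lemma Re_mulmx m n (M : 'M[R[i]]_(m, n)) (v : 'cV[R[i]]_n) k :
  complex.Re ((M *m v) k 0) =
  \sum_j (complex.Re (M k j) * complex.Re (v j 0)
          + - complex.Im (M k j) * complex.Im (v j 0)).
Proof. by rewrite mxE cRe_sum; apply: eq_bigr => j _; rewrite cReM mulNr. Qed.

Lemma Im_mulmx m n (M : 'M[R[i]]_(m, n)) (v : 'cV[R[i]]_n) k :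
  complex.Im ((M *m v) k 0) =
  \sum_j (complex.Re (M k j) * complex.Im (v j 0)
          + complex.Im (M k j) * complex.Re (v j 0)).
Proof. by rewrite mxE cIm_sum; apply: eq_bigr => j _; rewrite cImM. Qed.

Lemma trajectory_mulmx m n (M : 'M[R[i]]_(m, n)) (y d : R -> 'cV[R[i]]_n) :
  trajectory y d -> trajectory (fun t => M *m y t) (fun t => M *m d t).
Proof.
move=> [cy dy]; split=> [k | t t0 k]; split.
- rewrite (funext (fun t => Re_mulmx _ _ M (y t) k)).
  apply: within_continuous_sum => j; have [cr ci] := cy j.
  by apply: within_continuous_add; apply: within_continuous_mul => //;
    apply: within_continuous_cst.
- rewrite (funext (fun t => Im_mulmx _ _ M (y t) k)).
  apply: within_continuous_sum => j; have [cr ci] := cy j.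
  by apply: within_continuous_add; apply: within_continuous_mul => //;
    apply: within_continuous_cst.
- rewrite (funext (fun t => Re_mulmx _ _ M (y t) k)) Re_mulmx.
  apply: is_derive_sumf => j; have [dr di] := dy t t0 j.
  by apply: is_derive_addf; apply: is_derive_scalef.
- rewrite (funext (fun t => Im_mulmx _ _ M (y t) k)) Im_mulmx.
  apply: is_derive_sumf => j; have [dr di] := dy t t0 j.
  by apply: is_derive_addf; apply: is_derive_scalef.
Qed.

Lemma trajectory_col_mx m n (y d : R -> 'cV[R[i]]_m) (y' d' : R -> 'cV[R[i]]_n) :
  trajectory y d -> trajectory y' d' ->
  trajectory (fun t => col_mx (y t) (y' t)) (fun t => col_mx (d t) (d' t)).
Proof.
move=> [cy dy] [cy' dy']; split=> [k | t t0 k].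
- case: (split_ordP k) => j ->.
    by rewrite (funext (fun t => col_mxEu (y t) (y' t) j 0)).
  by rewrite (funext (fun t => col_mxEd (y t) (y' t) j 0)).
- case: (split_ordP k) => j ->.
    by rewrite col_mxEu (funext (fun t => col_mxEu (y t) (y' t) j 0)); apply: dy.
  by rewrite col_mxEd (funext (fun t => col_mxEd (y t) (y' t) j 0)); apply: dy'.
Qed.

Lemma sqmodE (w : R[i]) :
  sqmod w = complex.Re w * complex.Re w + complex.Im w * complex.Im w.
Proof. by rewrite -!expr2. Qed.

Lemma continuous_sqnorm n (y d : R -> 'cV[R[i]]_n) (T : R) : trajectory y d ->
  {within `[0, T], continuous (fun t => sqnorm (y t))}.
Proof.
move=> [cy _]; have sub : [set` `[0, T]] `<=` [set` `[0, +oo[].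
  by move=> t /=; rewrite !in_itv /= => /andP[-> _].
apply: (continuous_subspaceW sub).
apply: within_continuous_sum => k; have [cr ci] := cy k.
rewrite (funext (fun t => sqmodE (y t k 0))).
by apply: within_continuous_add; apply: within_continuous_mul.
Qed.

Lemma is_derive_sqnorm n (y d : R -> 'cV[R[i]]_n) (t : R) : trajectory y d ->
  0 < t -> is_derive t 1 (fun s => sqnorm (y s)) (2 * rdot (y t) (d t)).
Proof.
move=> [_ dy] t0; rewrite rdotE mulr_sumr.
apply: is_derive_sumf => k; have [dr di] := dy t t0 k.
set v := 2 * _.
have -> : v = (complex.Re (y t k 0) * complex.Re (d t k 0)
             + complex.Re (y t k 0) * complex.Re (d t k 0))
             + (complex.Im (y t k 0) * complex.Im (d t k 0)
             + complex.Im (y t k 0) * complex.Im (d t k 0)) by rewrite /v; ring.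
rewrite (funext (fun t => sqmodE (y t k 0))).
by apply: is_derive_addf; apply: is_derive_mulf.
Qed.

(** q t = exp (delta t) |y t|^2 satisfies q' <= - th q + F / th: the rate
    - 2 th of the unforced motion loses th to Young's inequality applied to
    2 Re (y^* f). *)
Lemma energy_decay n (y d f : R -> 'cV[R[i]]_n) (delta th F T : R) :
  trajectory y d -> 0 < th -> 0 <= F ->
  (forall t, 0 < t < T ->
     rdot (y t) (d t) <= - (th + delta / 2) * sqnorm (y t) + rdot (y t) (f t)) ->
  (forall t, 0 < t < T -> sqnorm (f t) <= F * expR (- delta * t)) ->
  forall t, 0 <= t <= T ->
    sqnorm (y t) <= (sqnorm (y 0) + F / th ^+ 2) * expR (- delta * t).
Proof.
move=> ty th0 F0 dle fle t tT.
pose q s := expR (delta * s) * sqnorm (y s).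
suff : q t <= q 0 + F / th / th.
  rewrite /q mulr0 expR0 mul1r mulNr expRN => h.
  by rewrite ler_pdivlMr ?expR_gt0 // mulrC expr2 invfM mulrA.
apply: (@dissipation_bound _ q (fun s => expR (delta * s) * (2 * rdot (y s) (d s))
   + sqnorm (y s) * (delta * expR (delta * s))) T) => //.
- apply: within_continuous_mul; first exact: within_continuous_exp_scale.
  exact: continuous_sqnorm ty.
- move=> s /andP[s0 _]; apply: is_derive_mulf; first exact: is_derive_exp_scale.
  exact: is_derive_sqnorm ty s0.
- move=> s sT; rewrite /q.
  set E := expR _.
  have E0 : 0 < E by apply: expR_gt0.
  have fE : E * sqnorm (f s) <= F.
    by have := fle s sT; rewrite mulNr expRN ler_pdivlMr ?expR_gt0 // mulrC.
  have yg := rdot_young _ (y s) (f s) _ th0.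
  have dl := dle s sT.
  have h : 2 * rdot (y s) (d s) + delta * sqnorm (y s)
           <= - th * sqnorm (y s) + th^-1 * sqnorm (f s) by lra.
  have h1 : E * (2 * rdot (y s) (d s) + delta * sqnorm (y s))
           <= E * (- th * sqnorm (y s) + th^-1 * sqnorm (f s)) by rewrite ler_pM2l.
  have h2 : th^-1 * (E * sqnorm (f s)) <= th^-1 * F by rewrite ler_pM2l ?invr_gt0.
  lra.
- by rewrite divr_ge0 // ltW.
- by rewrite /q mulr0 expR0 mul1r sqnorm_ge0.
Qed.

End Trajectories.

(** * Square summable sequences; scalar and triangular systems *)

Section Series.
Context {R : realType}.

Lemma series_le_limn (u : nat -> R) N :
  (forall i, 0 <= u i) -> cvgn (series u) -> series u N <= limn (series u).
Proof.
move=> u0 cu; apply: nondecreasing_cvgn_le => //.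
by apply: nondecreasing_series => i _ _; apply: u0.
Qed.

Lemma series_limn_le (u : nat -> R) (M : R) :
  cvgn (series u) -> (forall N, series u N <= M) -> limn (series u) <= M.
Proof. by move=> cu uM; apply: limr_le => //; near=> N; apply: uM. Unshelve. all: by end_near. Qed.

Lemma bounded_series_cvg (u : nat -> R) (M : R) :
  (forall i, 0 <= u i) -> (forall N, series u N <= M) -> cvgn (series u).
Proof.
move=> u0 uM; apply: nondecreasing_is_cvgn.
  by apply: nondecreasing_series => i _ _; apply: u0.
by exists M => _ [N _ <-].
Qed.

Lemma limn_series_ge0 (u : nat -> R) :
  (forall i, 0 <= u i) -> cvgn (series u) -> 0 <= limn (series u).
Proof.
by move=> u0 cu; have := series_le_limn u 0 u0 cu; rewrite /series /= big_geq.
Qed.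

Lemma finite_support_series (u : nat -> R) N :
  (forall i, (N <= i)%N -> u i = 0) ->
  cvgn (series u) /\ limn (series u) = series u N.
Proof.
move=> u0.
have h : \forall n \near \oo, series u n = series u N.
  near=> n; have Nn : (N <= n)%N by near: n; exact: nbhs_infty_ge.
  rewrite /series /= (big_cat_nat (n := N)) //=.
  rewrite [X in _ + X](_ : _ = 0) ?addr0 // big_nat_cond.
  by apply: big1 => i /andP[/andP[Ni _] _]; apply: u0.
split; first exact: is_cvg_near_cst h.
exact: lim_near_cst h.
Unshelve. all: by end_near. Qed.

Lemma l2sq_ge0 (z : nat -> R[i]) : l2 z -> 0 <= l2sq z.
Proof. by move=> lz; apply: limn_series_ge0 => // i; apply: sqmod_ge0. Qed.

Lemma cvg_sumf n (f : 'I_n -> nat -> R) (l : 'I_n -> R) :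
  (forall k, f k N @[N --> \oo] --> l k) ->
  (\sum_k f k N) @[N --> \oo] --> \sum_k l k.
Proof.
elim: n f l => [|n IH] f l cf.
  rewrite big_ord0 (_ : (fun N => _) = fun=> 0); first exact: cvg_cst.
  by apply/funext => N; rewrite big_ord0.
rewrite big_ord_recl.
rewrite (_ : (fun N => _) = fun N => f ord0 N + \sum_k f (lift ord0 k) N); last first.
  by apply/funext => N; rewrite big_ord_recl.
by apply: cvgD => //; apply: IH.
Qed.

Lemma Re_Im_mul_le (a b : R[i]) :
  `|complex.Re (a * b)| <= sqmod a + sqmod b /\
  `|complex.Im (a * b)| <= sqmod a + sqmod b.
Proof.
rewrite cReM cImM /sqmod.
move: (complex.Re a) (complex.Im a) (complex.Re b) (complex.Im b) => x y u v.
have h1 := sqr_ge0 (x - u); have h2 := sqr_ge0 (x + u).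
have h3 := sqr_ge0 (y - v); have h4 := sqr_ge0 (y + v).
have k1 := sqr_ge0 (x - v); have k2 := sqr_ge0 (x + v).
have k3 := sqr_ge0 (y - u); have k4 := sqr_ge0 (y + u).
have x0 := sqr_ge0 x; have y0 := sqr_ge0 y; have u0 := sqr_ge0 u; have v0 := sqr_ge0 v.
rewrite !sqrrB !sqrrD in h1 h2 h3 h4 k1 k2 k3 k4.
by split; rewrite ler_norml; apply/andP; split; nra.
Qed.

Lemma l2_mul_cvg (a b : nat -> R[i]) : l2 a -> l2 b ->
  cvgn (series (fun i => complex.Re (a i * b i))) /\
  cvgn (series (fun i => complex.Im (a i * b i))).
Proof.
move=> la lb.
have cs : cvgn (series (fun i => sqmod (a i) + sqmod (b i))).
  exact: (is_cvg_seriesD la lb).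
have h i := Re_Im_mul_le (a i) (b i).
by split; apply: normed_cvg; (apply: series_le_cvg cs => i //=;
  first by rewrite addr_ge0 ?sqmod_ge0); [exact: (h i).1 | exact: (h i).2].
Qed.

Definition series_col {p} (c : nat -> 'cV[R[i]]_p) (z : nat -> R[i]) : 'cV[R[i]]_p :=
  \col_(j < p) csum (fun i => c i j 0 * z i).

(** Cauchy-Schwarz for each row of the partial sums, then a passage to the
    limit, allowed because the products c_i z_i are absolutely summable.
    Multiplying by T first keeps the weight of the Lyapunov function inside the
    sum, which is what the second factor of rho measures. *)
Lemma sqnorm_series_col_le p q (T : 'M[R[i]]_(q, p)) (c : nat -> 'cV[R[i]]_p) z :
  (forall j, l2 (fun i => c i j 0)) -> l2 z ->
  cvgn (series (fun i => sqnorm (T *m c i))) ->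
  sqnorm (T *m series_col c z) <= limn (series (fun i => sqnorm (T *m c i))) * l2sq z.
Proof.
move=> lc lz cg.
pose zeta N : 'cV[R[i]]_p := \col_(j < p) \sum_(0 <= i < N) c i j 0 * z i.
have cRe j : complex.Re (zeta N j 0) @[N --> \oo] --> complex.Re (series_col c z j 0).
  rewrite mxE /csum /= (_ : (fun N => _) = series (fun i => complex.Re (c i j 0 * z i))).
    exact: (l2_mul_cvg _ _ (lc j) lz).1.
  by apply/funext => N; rewrite mxE cRe_sum.
have cIm j : complex.Im (zeta N j 0) @[N --> \oo] --> complex.Im (series_col c z j 0).
  rewrite mxE /csum /= (_ : (fun N => _) = series (fun i => complex.Im (c i j 0 * z i))).
    exact: (l2_mul_cvg _ _ (lc j) lz).2.
  by apply/funext => N; rewrite mxE cIm_sum.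
have cT : sqnorm (T *m zeta N) @[N --> \oo] --> sqnorm (T *m series_col c z).
  rewrite /sqnorm; apply: cvg_sumf => k; rewrite sqmodE.
  rewrite (funext (fun N => sqmodE ((T *m zeta N) k 0))).
  have cr : complex.Re ((T *m zeta N) k 0) @[N --> \oo]
              --> complex.Re ((T *m series_col c z) k 0).
    rewrite Re_mulmx (funext (fun N => Re_mulmx _ _ T (zeta N) k)).
    by apply: cvg_sumf => j; apply: cvgD; apply: cvgM => //; apply: cvg_cst.
  have ci : complex.Im ((T *m zeta N) k 0) @[N --> \oo]
              --> complex.Im ((T *m series_col c z) k 0).
    rewrite Im_mulmx (funext (fun N => Im_mulmx _ _ T (zeta N) k)).
    by apply: cvg_sumf => j; apply: cvgD; apply: cvgM => //; apply: cvg_cst.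
  by apply: cvgD; apply: cvgM.
rewrite -(cvg_lim _ cT) //; apply: limr_le; first by apply/cvg_ex; eexists; exact: cT.
near=> N.
have Tz : T *m zeta N = \col_k \sum_(0 <= i < N) (T *m c i) k 0 * z i.
  apply/colP => k; rewrite !mxE.
  under eq_bigr do rewrite mxE mulr_sumr.
  rewrite exchange_big /=; apply: eq_bigr => i _.
  by rewrite mxE mulr_suml; apply: eq_bigr => j _; rewrite mulrA.
have z0 : 0 <= series (fun i => sqmod (z i)) N.
  by apply: sumr_ge0 => *; apply: sqmod_ge0.
apply: (@le_trans _ _ (series (fun i => sqnorm (T *m c i)) N
                       * series (fun i => sqmod (z i)) N)).
  rewrite /sqnorm /series /= exchange_big /= mulr_suml; apply: ler_sum => k _.
  rewrite Tz mxE; exact: cauchy_schwarz.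
apply: ler_pM => //.
- by apply: sumr_ge0 => *; apply: sqnorm_ge0.
- by apply: series_le_limn => // i; apply: sqnorm_ge0.
- by apply: series_le_limn => // i; apply: sqmod_ge0.
Unshelve. all: by end_near. Qed.

End Series.

Section ScalarAndTriangular.
Context {R : realType}.

Lemma sqnorm_scalar (w : R[i]) : sqnorm (w%:M : 'cV[R[i]]_1) = sqmod w.
Proof. by rewrite /sqnorm big_ord1 mxE mulr1n. Qed.

Lemma scalar_trajectory (y d : R -> R[i]) :
  ccontinuous_within `[0, +oo[ y -> (forall t, 0 < t -> has_cderive y t (d t)) ->
  trajectory (fun t => (y t)%:M : 'cV[R[i]]_1) (fun t => (d t)%:M).
Proof.
move=> cy dy; have E (w : R[i]) (k : 'I_1) : (w%:M : 'cV[R[i]]_1) k 0 = w.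
  by rewrite !ord1 mxE mulr1n.
split=> [k | t t0 k].
  by rewrite (funext (fun t => E (y t) k)).
by rewrite (funext (fun t => E (y t) k)) E; apply: dy.
Qed.

Lemma scalar_decay (y f : R -> R[i]) (a : R[i]) (delta s F T : R) :
  ccontinuous_within `[0, +oo[ y ->
  (forall t, 0 < t -> has_cderive y t (a * y t + f t)) ->
  delta / 2 < s -> complex.Re a <= - s -> 0 <= F ->
  (forall t, 0 < t < T -> sqmod (f t) <= F * expR (- delta * t)) ->
  forall t, 0 <= t <= T ->
    sqmod (y t) <= (sqmod (y 0) + F / (s - delta / 2) ^+ 2) * expR (- delta * t).
Proof.
move=> cy dy ds as_ F0 fle t tT.
rewrite -2!sqnorm_scalar.
apply: (energy_decay _ (fun t => (y t)%:M) (fun t => (a * y t + f t)%:M)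
  (fun t => (f t)%:M) _ _ _ T) => //.
- exact: scalar_trajectory.
- by rewrite subr_gt0.
- move=> r rT; rewrite subrK raddfD rdotDr lerD2r /=.
  rewrite rdotE big_ord1 !mxE !mulr1n /sqnorm big_ord1 !mxE !mulr1n cReM cImM /sqmod.
  set v := _ + _.
  have -> : v = complex.Re a * (complex.Re (y r) ^+ 2 + complex.Im (y r) ^+ 2).
    by rewrite /v; ring.
  by apply: ler_wpM2r => //; rewrite addr_ge0 ?sqr_ge0.
- by move=> r rT; rewrite sqnorm_scalar; apply: fle.
Qed.

(** Back substitution: component k is a scalar equation forced by f and by the
    components of larger index, which decay already.  The constant depends on
    the matrix only, not on the solution, the forcing or the horizon T. *)
Lemma triangular_decay n (M : 'M[R[i]]_n) (delta : R) :
  is_trig_mx M^T -> 0 < delta -> (forall k, complex.Re (M k k) <= - delta) ->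
  exists C : R, 0 <= C /\
    forall (y f : R -> 'cV[R[i]]_n) (F T : R),
      trajectory y (fun t => M *m y t + f t) -> 0 <= F ->
      (forall t, 0 < t < T -> sqnorm (f t) <= F * expR (- delta * t)) ->
      forall t, 0 <= t <= T ->
        sqnorm (y t) <= C * (sqnorm (y 0) + F) * expR (- delta * t).
Proof.
move=> /is_trig_mxP tM d0 reM.
have low (i j : 'I_n) : (j < i)%N -> M i j = 0 by move=> /tM; rewrite mxE.
suff /(_ n)[C [C0 hC]] : forall p, exists C : R, 0 <= C /\
    forall (y f : R -> 'cV[R[i]]_n) (F T : R),
      trajectory y (fun t => M *m y t + f t) -> 0 <= F ->
      (forall t, 0 < t < T -> sqnorm (f t) <= F * expR (- delta * t)) ->
      forall k : 'I_n, (n - k <= p)%N -> forall t, 0 <= t <= T ->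
        sqmod (y t k 0) <= C * (sqnorm (y 0) + F) * expR (- delta * t).
  exists (n%:R * C); split; first by rewrite mulr_ge0.
  move=> y f F T ty F0 fle t tT.
  have -> : n%:R * C * (sqnorm (y 0) + F) * expR (- delta * t) =
      \sum_(k < n) C * (sqnorm (y 0) + F) * expR (- delta * t).
    by rewrite sumr_const card_ord -[RHS]mulr_natl !mulrA.
  by apply: ler_sum => k _; apply: (hC y f F T) => //; apply: leq_subr.
elim=> [|p [C [C0 IH]]].
  exists 0; split=> // y f F T _ _ _ k.
  by rewrite leqn0 subn_eq0 leqNgt ltn_ord.
pose C' := 1 + (delta / 2) ^- 2 * (2 + 2 * sqfrob M * (n%:R * C)).
have d20 : 0 < (delta / 2) ^+ 2 by rewrite exprn_gt0 // divr_gt0.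
have C'0 : 0 <= C'.
  by rewrite addr_ge0 // mulr_ge0 ?invr_ge0 ?(ltW d20) // addr_ge0 // !mulr_ge0 // sqfrob_ge0.
exists C'; split=> // y f F T ty F0 fle k kp t tT.
pose X := sqnorm (y 0) + F.
have X0 : 0 <= X by rewrite addr_ge0 // sqnorm_ge0.
(* [h] is the forcing of component k: f and the part of M above the diagonal. *)
pose g (j : 'I_n) s : R[i] := if (k < j)%N then y s j 0 else 0.
pose h s : R[i] := f s k 0 + \sum_j M k j * g j s.
pose H := 2 * F + 2 * (sqfrob M * (n%:R * C * X)).
have H0 : 0 <= H.
  by rewrite addr_ge0 // !mulr_ge0 // sqfrob_ge0.
have hle s : 0 < s < T -> sqmod (h s) <= H * expR (- delta * s).
  move=> sT; apply: le_trans (sqmodD_le _ _) _.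
  rewrite [leRHS]mulrDl lerD // -!mulrA ler_pM2l //.
    exact: le_trans (sqmod_le_sqnorm _ _ k) (fle s sT).
  apply: le_trans (cauchy_schwarz _ _ _ _) _.
  apply: ler_pM.
  - by apply: sumr_ge0 => *; apply: sqmod_ge0.
  - by apply: sumr_ge0 => *; apply: sqmod_ge0.
  - rewrite /sqfrob [leRHS](bigD1 k) //= lerDl sumr_ge0 // => i _.
    by rewrite sumr_ge0 // => *; rewrite sqmod_ge0.
  - rewrite [leRHS](_ : _ = \sum_(j < n) C * X * expR (- delta * s)); last first.
    by rewrite sumr_const card_ord -[RHS]mulr_natl !mulrA.
  apply: ler_sum => j _; rewrite /g; case: ifP => kj.
    apply: (IH y f F T) => //; last by case/andP: sT => ? ?; rewrite !ltW.
    by apply: leq_trans (_ : n - k.+1 <= p)%N; rewrite ?leq_sub2l // subnS -subn1 leq_subLR add1n.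
  by rewrite sqmod0 !mulr_ge0 // expR_ge0.
have dy s : 0 < s -> has_cderive (fun r => y r k 0) s (M k k * y s k 0 + h s).
  move=> s0; have := ty.2 s s0 k.
  suff -> : (M *m y s + f s) k 0 = M k k * y s k 0 + h s by [].
  rewrite mxE addrC /h addrCA; congr (_ + _); rewrite mxE.
  rewrite (bigD1 k) //= [X in _ = _ + X](bigD1 k) //= {1}/g ltnn mulr0 add0r.
  congr (_ + _); apply: eq_bigr => j jk; rewrite /g; case: ltnP => // jk'.
  by rewrite mulr0 low ?mul0r // ltn_neqAle jk' andbT.
have := @scalar_decay _ _ _ delta delta H T (ty.1 k) dy _ (reM k) H0 hle t tT.
have -> : delta - delta / 2 = delta / 2 by field.
move=> /(_ _)/le_trans; apply; first by rewrite ltr_pdivrMr // mulr_natr mulr2n ltrDl.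
rewrite ler_pM2r ?expR_gt0 // -/X.
have y0X : sqmod (y 0 k 0) <= X.
  by apply: le_trans (sqmod_le_sqnorm _ _ k) _; rewrite lerDl.
have FX : F <= X by rewrite lerDr sqnorm_ge0.
rewrite [leRHS]mulrDl mul1r lerD // [leLHS]mulrC -[leRHS]mulrA ler_pM2l ?invr_gt0 //.
by rewrite [leRHS]mulrDl lerD ?ler_pM2l // !mulrA.
Qed.

End ScalarAndTriangular.

(** * Gains of the tail and error coordinates *)

Section ModalGains.
Context {R : realType} {nu ny n0 m : nat}.
Variables (A : operator R) (B : 'cV[R[i]]_nu -> nat -> R[i])
  (C : (nat -> R[i]) -> 'cV[R[i]]_ny) (D : modal_data R nu ny n0 m)
  (Phi : (nat -> R[i]) -> 'cV[R[i]]_(n0 + m) * (nat -> R[i])).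
Hypotheses (hB : bounded_input B) (hC : bounded_output C)
  (hPhi : conjugates A B C D Phi).

Lemma tail_input_l2 (u : 'cV[R[i]]_nu) : l2 (fun i => (mb D i *m u) 0 0).
Proof.
have [lB _ _] := hB; have [fPhi _ _] := Phi_bij hPhi.
by have := fPhi _ (lB u); rewrite /= (Phi_B hPhi).
Qed.

(** The output map is bounded, so test it on the truncation
    z_i = conj (c_i j), i < N: the output is then S = sum_(i < N) |c_i j|^2 and
    boundedness gives S^2 <= const * S.  Only finite sums occur, as convergence
    of the output series is not known beforehand. *)
Lemma tail_output_l2 (j : 'I_ny) : l2 (fun i => mc D i j 0).
Proof.
have [_ [M hM]] := hC; have [M' hM'] := Phi_inv_continuous hPhi.
have [_ _ sPhi] := Phi_bij hPhi.
pose c i := mc D i j 0.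
apply: (bounded_series_cvg _ (`|M| * `|M'|)) => [i | N]; first exact: sqmod_ge0.
set S := series _ N.
have S0 : 0 <= S by apply: sumr_ge0 => *; apply: sqmod_ge0.
pose z i : R[i] := if (i < N)%N then Num.conj (c i) else 0.
have zN i : (N <= i)%N -> sqmod (z i) = 0.
  by rewrite /z leqNgt => /negbTE ->; rewrite sqmod0.
have [lz Ez] := finite_support_series _ _ zN.
have zS : l2sq z = S.
  rewrite /l2sq Ez /S /series /= big_nat_cond [RHS]big_nat_cond.
  apply: eq_bigr => i /andP[/andP[_ iN] _].
  by rewrite /z iN sqmod_conj.
have [x lx Ex] := sPhi (0, z) lz.
have sC : sqmod (C x j 0) = S ^+ 2.
  rewrite (Phi_C hPhi lx) Ex /modal_output /= mulmx0 add0r mxE /csum.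
  have cz i : (N <= i)%N -> c i * z i = 0.
    by rewrite /z leqNgt => /negbTE ->; rewrite mulr0.
  have czS i : (i < N)%N -> c i * z i = (sqmod (c i))%:C.
    by rewrite /z => ->; rewrite mulrC conj_mul_sqmod.
  rewrite (finite_support_series _ N _).2; last by move=> i iN; rewrite -/(c i) cz.
  rewrite (finite_support_series _ N _).2; last by move=> i iN; rewrite -/(c i) cz.
  rewrite /sqmod /= /series /=.
  rewrite [X in X ^+ 2 + _](_ : _ = S).
    rewrite [X in _ + X ^+ 2](_ : _ = 0) ?expr0n ?addr0 //.
    rewrite big_nat_cond big1 // => i /andP[/andP[_ iN] _].
    by rewrite -/(c i) czS.
  rewrite /S /series /= big_nat_cond [RHS]big_nat_cond.
  apply: eq_bigr => i /andP[/andP[_ iN] _].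
  by rewrite -/(c i) czS.
have [->|Sn0] := eqVneq S 0; first by rewrite mulr_ge0.
have Spos : 0 < S by rewrite lt_def Sn0.
rewrite -(ler_pM2r Spos) -expr2 -sC.
apply: le_trans (sqmod_le_sqnorm _ _ j) _.
apply: le_trans (hM _ lx) _.
have lx0 : 0 <= l2sq x by apply: l2sq_ge0.
apply: (@le_trans _ _ (`|M| * l2sq x)); first by apply: ler_wpM2r => //; apply: ler_norm.
rewrite -mulrA ler_wpM2l //.
apply: le_trans (hM' _ lx) _.
rewrite Ex /= zS /sqnorm big1 ?add0r => [|k _]; last by rewrite mxE sqmod0.
by apply: ler_wpM2r => //; apply: ler_norm.
Qed.

Lemma sqfrob_cols p q (T : 'M[R[i]]_(p, q)) :
  sqfrob T = \sum_(j < q) sqnorm (col j T).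
Proof.
rewrite /sqfrob exchange_big /=; apply: eq_bigr => j _.
by apply: eq_bigr => i _; rewrite mxE.
Qed.

Lemma cvg_series_sum q (f : 'I_q -> nat -> R) :
  (forall k, cvgn (series (f k))) -> cvgn (series (fun i => \sum_k f k i)).
Proof.
move=> cf; apply/cvg_ex; exists (\sum_k limn (series (f k))).
rewrite (_ : series _ = fun N => \sum_k series (f k) N).
  by apply: cvg_sumf => k; apply: cf.
by apply/funext => N; rewrite /series /= exchange_big.
Qed.

(** The columns of K0 are inputs, to which [tail_input_l2] applies. *)
Lemma input_gain_cvg (K0 : 'M[R[i]]_(nu, n0)) :
  cvgn (series (fun i => sqfrob (mb D i *m K0))).
Proof.
rewrite (_ : (fun i => _) = fun i => \sum_(j < n0) sqmod ((mb D i *m col j K0) 0 0)).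
  by apply: cvg_series_sum => j; apply: tail_input_l2.
apply/funext => i; rewrite sqfrob_cols; apply: eq_bigr => j _.
by rewrite [col j K0]colE mulmxA -colE /sqnorm big_ord1.
Qed.

Lemma output_gain_cvg p (T : 'M[R[i]]_(p, ny)) :
  cvgn (series (fun i => sqnorm (T *m mc D i))).
Proof.
have cc : cvgn (series (fun i => sqnorm (mc D i))).
  by apply: cvg_series_sum => j; apply: tail_output_l2.
apply: (@series_le_cvg _ _ (fun i => sqfrob T * sqnorm (mc D i))).
- by move=> i; apply: sqnorm_ge0.
- by move=> i; rewrite mulr_ge0 ?sqfrob_ge0 ?sqnorm_ge0.
- by move=> i; apply: sqnorm_mulmx_le.
- exact: (is_cvg_seriesZ cc).
Qed.

End ModalGains.

Section ErrorCoordinates.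
Context {R : realType}.

Lemma trajectory_ext n (y y' d d' : R -> 'cV[R[i]]_n) :
  trajectory y d -> (forall t, y t = y' t) -> (forall t, 0 < t -> d t = d' t) ->
  trajectory y' d'.
Proof.
move=> [cy dy] /funext <- dd; split=> // t t0 k.
by rewrite -dd //; apply: dy.
Qed.

Lemma trajectory_sub n (y y' d d' : R -> 'cV[R[i]]_n) :
  trajectory y d -> trajectory y' d' ->
  trajectory (fun t => y t - y' t) (fun t => d t - d' t).
Proof.
move=> ty ty'.
have ty2 := trajectory_mulmx _ _ (row_mx 1%:M (- 1%:M)) _ _
  (trajectory_col_mx _ _ _ _ _ _ ty ty').
by apply: trajectory_ext ty2 _ _ => [t|t _]; rewrite mul_row_col mulNmx !mul1mx.
Qed.

Lemma trajectory_usubmx m n (y d : R -> 'cV[R[i]]_(m + n)) :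
  trajectory y d -> trajectory (fun t => usubmx (y t)) (fun t => usubmx (d t)).
Proof.
move=> ty; apply: trajectory_ext (trajectory_mulmx _ _ (row_mx 1%:M 0) _ _ ty) _ _.
  by move=> t; rewrite -[y t in LHS]vsubmxK mul_row_col mul1mx mul0mx addr0.
by move=> t _; rewrite -[d t in LHS]vsubmxK mul_row_col mul1mx mul0mx addr0.
Qed.

Lemma trajectory_dsubmx m n (y d : R -> 'cV[R[i]]_(m + n)) :
  trajectory y d -> trajectory (fun t => dsubmx (y t)) (fun t => dsubmx (d t)).
Proof.
move=> ty; apply: trajectory_ext (trajectory_mulmx _ _ (row_mx 0 1%:M) _ _ ty) _ _.
  by move=> t; rewrite -[y t in LHS]vsubmxK mul_row_col mul1mx mul0mx add0r.
by move=> t _; rewrite -[d t in LHS]vsubmxK mul_row_col mul1mx mul0mx add0r.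
Qed.

Context {nu ny n0 m : nat} (D : modal_data R nu ny n0 m)
  (K0 : 'M[R[i]]_(nu, n0)) (G0 : 'M[R[i]]_(n0, ny))
  (x : R -> 'cV[R[i]]_(n0 + m)) (z : R -> nat -> R[i]) (xh : R -> 'cV[R[i]]_(n0 + m)).
Hypothesis sol : closed_loop_solution D
  (block_mx (mA0 D + G0 *m mC0 D) (G0 *m mC1 D) 0 (mA1 D)) (col_mx (- G0) 0)
  (mB D) (row_mx K0 0) x z xh.

Definition slow_state t : 'cV[R[i]]_(n0 + n0) :=
  col_mx (usubmx (xh t)) (usubmx (x t) - usubmx (xh t)).

Definition fast_error t : 'cV[R[i]]_m := dsubmx (x t) - dsubmx (xh t).

Lemma feedbackE (v : 'cV[R[i]]_(n0 + m)) : row_mx K0 0 *m v = K0 *m usubmx v.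
Proof. by rewrite -[v in LHS]vsubmxK mul_row_col mul0mx addr0. Qed.

Lemma state_trajectory :
  trajectory x (fun t => col_mx
    (mA0 D *m usubmx (x t) + mB0 D *m (K0 *m usubmx (xh t)))
    (mA1 D *m dsubmx (x t) + mB1 D *m (K0 *m usubmx (xh t)))).
Proof.
have tx : trajectory x (fun t => mA D *m x t + mB D *m (row_mx K0 0 *m xh t)).
  by split; [exact: (sol_x_cont sol) | exact: (sol_x sol)].
apply: trajectory_ext tx _ _ => // t _; rewrite feedbackE.
rewrite -[x t in LHS]vsubmxK mul_block_col mul_col_mx.
by rewrite !mul0mx addr0 add0r add_col_mx.
Qed.

Lemma observer_trajectory :
  trajectory xh (fun t => col_mx
    ((mA0 D + G0 *m mC0 D) *m usubmx (xh t) + G0 *m mC1 D *m dsubmx (xh t)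
       - G0 *m modal_output D (x t) (z t) + mB0 D *m (K0 *m usubmx (xh t)))
    (mA1 D *m dsubmx (xh t) + mB1 D *m (K0 *m usubmx (xh t)))).
Proof.
have tx : trajectory xh (fun t =>
    block_mx (mA0 D + G0 *m mC0 D) (G0 *m mC1 D) 0 (mA1 D) *m xh t
    + col_mx (- G0) 0 *m modal_output D (x t) (z t)
    + mB D *m (row_mx K0 0 *m xh t)).
  by split; [exact: (sol_xh_cont sol) | exact: (sol_xh sol)].
apply: trajectory_ext tx _ _ => // t _; rewrite feedbackE.
rewrite -{1}[xh t]vsubmxK mul_block_col !mul_col_mx.
by rewrite !mul0mx add0r !add_col_mx addr0 mulNmx.
Qed.

(** The feedback B0 K0 xh0 cancels in the equation of x0 - xh0, and the
    observer cancels C1 xh1, so only the error e and the tail act on w. *)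
Lemma slow_state_trajectory :
  trajectory slow_state (fun t => mF0 D K0 G0 *m slow_state t
    + col_mx (- G0) G0 *m (mC1 D *m fast_error t + series_col (mc D) (z t))).
Proof.
have tx := trajectory_usubmx _ _ _ _ state_trajectory.
have th := trajectory_usubmx _ _ _ _ observer_trajectory.
apply: trajectory_ext (trajectory_col_mx _ _ _ _ _ _ th (trajectory_sub _ _ _ _ _ tx th)) _ _ => // t _.
rewrite /slow_state mul_block_col mul_col_mx add_col_mx !col_mxKu mul0mx add0r.
have Cx : mC D *m x t = mC0 D *m usubmx (x t) + mC1 D *m dsubmx (x t).
  by rewrite -{1}[x t]vsubmxK mul_row_col.
rewrite /modal_output Cx -/(series_col (mc D) (z t)) /fast_error.
move: (usubmx (x t)) (dsubmx (x t)) (usubmx (xh t)) (dsubmx (xh t)) => x0 x1 h0 h1.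
rewrite !(mulmxDl, mulmxDr, mulNmx, mulmxN, mulmxA, opprD, opprK).
congr col_mx; apply/matrixP => i j; rewrite !mxE; ring.
Qed.

Lemma fast_error_trajectory :
  trajectory fast_error (fun t => mA1 D *m fast_error t + 0).
Proof.
have tx := trajectory_dsubmx _ _ _ _ state_trajectory.
have th := trajectory_dsubmx _ _ _ _ observer_trajectory.
apply: trajectory_ext (trajectory_sub _ _ _ _ _ tx th) _ _ => // t _.
rewrite !col_mxKd /fast_error addr0 mulmxBr opprD addrACA.
by rewrite subrr addr0.
Qed.

Lemma fast_observer_trajectory :
  trajectory (fun t => dsubmx (xh t))
    (fun t => mA1 D *m dsubmx (xh t) + mB1 D *m K0 *m usubmx (xh t)).
Proof.
apply: trajectory_ext (trajectory_dsubmx _ _ _ _ observer_trajectory) _ _ => // t _.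
by rewrite col_mxKd mulmxA.
Qed.

Lemma total_norm_le t :
  sqnorm (x t) + l2sq (z t) + sqnorm (xh t)
    <= 3 * sqnorm (slow_state t) + 2 * sqnorm (fast_error t)
       + 3 * sqnorm (dsubmx (xh t)) + l2sq (z t).
Proof.
rewrite /slow_state /fast_error.
rewrite -{1}(vsubmxK (x t)) -{1}(vsubmxK (xh t)) !sqnorm_col_mx.
move: (usubmx (x t)) (dsubmx (x t)) (usubmx (xh t)) (dsubmx (xh t)) => x0 x1 h0 h1.
have := sqnormD_le _ (x0 - h0) h0; have := sqnormD_le _ (x1 - h1) h1; rewrite !subrK.
have := sqnorm_ge0 _ (x0 - h0).
lra.
Qed.

Lemma initial_norm_le :
  sqnorm (slow_state 0) <= 3 * (sqnorm (x 0) + sqnorm (xh 0)) /\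
  sqnorm (fast_error 0) <= 2 * (sqnorm (x 0) + sqnorm (xh 0)).
Proof.
rewrite /slow_state /fast_error -(vsubmxK (x 0)) -(vsubmxK (xh 0)) !sqnorm_col_mx.
rewrite !col_mxKu !col_mxKd.
move: (usubmx (x 0)) (dsubmx (x 0)) (usubmx (xh 0)) (dsubmx (xh 0)) => x0 x1 h0 h1.
have := sqnormD_le _ x0 (- h0); have := sqnormD_le _ x1 (- h1); rewrite !sqnormN.
have := sqnorm_ge0 _ x0; have := sqnorm_ge0 _ x1.
have := sqnorm_ge0 _ h0; have := sqnorm_ge0 _ h1.
by move=> ? ? ? ? ? ?; split; lra.
Qed.

End ErrorCoordinates.

(** * The small-gain argument *)

Section SmallGain.
Context {R : realType}.

Lemma tail_l2sq_le (z z0 : nat -> R[i]) (b : nat -> R) (c E : R) :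
  l2 z -> l2 z0 -> (forall i, 0 <= b i) -> cvgn (series b) -> 0 <= c -> 0 <= E ->
  (forall i, sqmod (z i) <= (sqmod (z0 i) + b i * c) * E) ->
  l2sq z <= (l2sq z0 + limn (series b) * c) * E.
Proof.
move=> lz lz0 b0 cb c0 E0 hz; apply: series_limn_le => // N.
apply: (@le_trans _ _ (\sum_(0 <= i < N) (sqmod (z0 i) + b i * c) * E)).
  by apply: ler_sum => i _; apply: hz.
rewrite -mulr_suml ler_wpM2r // big_split /= lerD // -?mulr_suml.
  by apply: (series_le_limn (fun i => sqmod (z0 i))) => // i; apply: sqmod_ge0.
by apply: ler_wpM2r => //; apply: (series_le_limn b).
Qed.

(** Compactness of [0, T] makes the weighted supremum finite, which is what
    allows a small-gain argument to absorb a fraction of it. *)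
Lemma weighted_sup n (y d : R -> 'cV[R[i]]_n) (delta T : R) :
  trajectory y d -> 0 <= T ->
  exists2 c, 0 <= c <= T & forall t, 0 <= t <= T ->
    sqnorm (y t) <= expR (delta * c) * sqnorm (y c) * expR (- delta * t).
Proof.
move=> ty T0.
have cq : {within `[0, T], continuous (fun t => expR (delta * t) * sqnorm (y t))}.
  apply: within_continuous_mul; first exact: within_continuous_exp_scale.
  exact: continuous_sqnorm ty.
have [c] := EVT_max T0 cq; rewrite in_itv /= => cT hc; exists c => // t tT.
have := hc t; rewrite in_itv /= => /(_ tT).
by rewrite mulNr expRN ler_pdivlMr ?expR_gt0 // mulrC.
Qed.

(** The supremum Q of the weighted energy of S w on
    the horizon is bounded by the initial data plus Q / 2, because the product
    of the gain of w |-> z and of the gain of z |-> w is at most 1/2. *)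
Lemma small_gain_stable (nu ny n0 m : nat) (D : modal_data R nu ny n0 m)
    (K0 : 'M[R[i]]_(nu, n0)) (G0 : 'M[R[i]]_(n0, ny)) (S : 'M[R[i]]_(n0 + n0))
    (delta p s : R) (b : nat -> R)
    (c := fun i => sqnorm (S *m col_mx (- G0) G0 *m mc D i)) :
  0 < delta -> 0 < p -> delta < s ->
  (forall v, rdot (S *m v) (S *m (mF0 D K0 G0 *m v)) <= - delta * sqnorm (S *m v)) ->
  (forall v, p * sqnorm v <= sqnorm (S *m v)) ->
  (forall i, 0 <= b i) -> cvgn (series b) ->
  (forall i v, sqmod ((mb D i *m (K0 *m v)) 0 0) <= b i * sqnorm v) ->
  (forall j, l2 (fun i => mc D i j 0)) -> cvgn (series c) ->
  (forall i, complex.Re (ma D i) <= - s) ->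
  is_trig_mx (mA1 D)^T -> (forall k, complex.Re (mA1 D k k) <= - delta) ->
  16 * limn (series b) * limn (series c) <= delta ^+ 2 * p * (s - delta) * s ->
  exponentially_stable delta D
    (block_mx (mA0 D + G0 *m mC0 D) (G0 *m mC1 D) 0 (mA1 D))
    (col_mx (- G0) 0) (mB D) (row_mx K0 0).
Proof.
move=> delta0 p0 ds lyapunov coercive b0 cb b_gain lc cc tail_rate trig1 rate1 small.
set G := col_mx (- G0) G0 in c cc small *.
have [Cd [Cd0 hCd]] := triangular_decay _ _ _ trig1 delta0 rate1.
pose Bt := limn (series b); pose Ct := limn (series c).
have Bt0 : 0 <= Bt by apply: limn_series_ge0.
have Ct0 : 0 <= Ct by apply: limn_series_ge0 => // i; apply: sqnorm_ge0.
pose th := s - delta / 2.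
have th0 : 0 < th by rewrite /th; lra.
pose k1 := sqfrob (S *m G *m mC1 D); have k10 : 0 <= k1 by apply: sqfrob_ge0.
pose kS := sqfrob S; have kS0 : 0 <= kS by apply: sqfrob_ge0.
pose kB := sqfrob (mB1 D *m K0); have kB0 : 0 <= kB by apply: sqfrob_ge0.
pose loop := Bt / (p * th ^+ 2).
have pth0 : 0 < p * th ^+ 2 by rewrite mulr_gt0 ?exprn_gt0.
have loop0 : 0 <= loop by rewrite divr_ge0 // ltW.
have d20 : 0 < (delta / 2) ^+ 2 by rewrite exprn_gt0 // divr_gt0.
(* This is where the bound on rho enters: (s - delta) s = th^2 - delta^2 / 4. *)
have contraction : 2 * Ct * loop / (delta / 2) ^+ 2 <= 2^-1.
  rewrite ler_pdivrMr // /loop mulrA ler_pdivrMr //.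
  have sth : (s - delta) * s <= th ^+ 2.
    rewrite -subr_ge0 (_ : _ - _ = (delta / 2) ^+ 2) ?(ltW d20) //.
    by rewrite /th; field.
  have h : delta ^+ 2 * p * ((s - delta) * s) <= delta ^+ 2 * p * th ^+ 2.
    by rewrite ler_wpM2l // mulr_ge0 ?sqr_ge0 // ltW.
  rewrite mulrA -/Bt -/Ct in small h.
  have -> : 2^-1 * (delta / 2) ^+ 2 * (p * th ^+ 2) = delta ^+ 2 * p * th ^+ 2 / 8 by field.
  lra.
pose a0 := 2 * k1 * Cd * 2 + 2 * Ct.
have a00 : 0 <= a0 by rewrite addr_ge0 ?mulr_ge0.
pose kap1 := 2 * (kS * 3 + a0 / (delta / 2) ^+ 2).
have kap10 : 0 <= kap1.
  by rewrite mulr_ge0 // addr_ge0 ?mulr_ge0 // invr_ge0 ltW.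
pose kappa := 1 + (3 * (kap1 / p) + 2 * (Cd * 2)
  + 3 * (Cd * (1 + kB * (kap1 / p))) + (1 + loop * kap1)).
have kp0 : 0 <= kap1 / p by rewrite divr_ge0 // ltW.
exists kappa; split.
  by rewrite lerDl; do ! [done | apply: addr_ge0 | apply: mulr_ge0].
move=> x z xh sol t t0.
pose X := sqnorm (x 0) + l2sq (z 0) + sqnorm (xh 0).
pose w := slow_state x xh; pose e := fast_error x xh.
have lz0 : l2 (z 0) by apply: (sol_l2 sol).
have Z0 : 0 <= l2sq (z 0) by apply: l2sq_ge0.
have x00 := sqnorm_ge0 _ (x 0); have xh00 := sqnorm_ge0 _ (xh 0).
have X0 : 0 <= X by rewrite !addr_ge0.
have [w0X e0X] := initial_norm_le x xh.
have E0 r : 0 < expR (- delta * r) by apply: expR_gt0.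
have tw := slow_state_trajectory D K0 G0 x z xh sol.
have ty := trajectory_mulmx _ _ S _ _ tw.
(* The horizon is the very time t at which the estimate is wanted. *)
have [r rt hr] := weighted_sup _ _ _ delta t ty t0.
rewrite -/w in ty hr w0X; rewrite -/e in e0X.
set Q := expR (delta * r) * sqnorm (S *m w r) in hr.
have Q0 : 0 <= Q by rewrite mulr_ge0 ?expR_ge0 ?sqnorm_ge0.
have wQ (tau : R) : 0 <= tau <= t -> sqnorm (w tau) <= Q / p * expR (- delta * tau).
  move=> htau; rewrite -(ler_pM2l p0); apply: le_trans (coercive _) _.
  by rewrite mulrA [p * _]mulrC divfK ?gt_eqF //; apply: hr.
have hQ (tau : R) : 0 <= tau <= t -> sqnorm (usubmx (xh tau)) <= Q / p * expR (- delta * tau).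
  move=> htau; apply: le_trans (wQ _ htau).
  by rewrite /w /slow_state sqnorm_col_mx lerDl sqnorm_ge0.
have Qp0 : 0 <= Q / p by rewrite divr_ge0 // ltW.
have zQ (tau : R) : 0 <= tau <= t ->
    l2sq (z tau) <= (l2sq (z 0) + loop * Q) * expR (- delta * tau).
  move=> htau.
  have -> : loop * Q = Bt * (Q / p / th ^+ 2).
    by rewrite /loop; field; rewrite !gt_eqF.
  apply: tail_l2sq_le => //.
  - by apply: (sol_l2 sol); case/andP: htau.
  - by rewrite divr_ge0 // sqr_ge0.
  move=> i.
  have -> : b i * (Q / p / th ^+ 2) = b i * (Q / p) / th ^+ 2 by rewrite mulrA.
  refine (@scalar_decay _ (fun r => z r i)
    (fun r => (mb D i *m (K0 *m usubmx (xh r))) 0 0) (ma D i) delta s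
    (b i * (Q / p)) t _ _ _ _ _ _ tau htau).
  - exact: (sol_z_cont sol).
  - by move=> q q0; have := sol_z sol q0 i; rewrite feedbackE.
  - by rewrite -subr_gt0.
  - exact: tail_rate.
  - exact: mulr_ge0.
  - move=> q /andP[q0 qt]; apply: le_trans (b_gain _ _) _.
    by rewrite -mulrA ler_wpM2l // hQ // !ltW.
have eX (tau : R) : 0 <= tau <= t -> sqnorm (e tau) <= Cd * 2 * X * expR (- delta * tau).
  move=> htau.
  have te := fast_error_trajectory D K0 G0 x z xh sol.
  apply: le_trans (hCd _ _ 0 t te (lexx 0) _ _ htau) _.
    by move=> q _; rewrite mul0r /sqnorm big1 // => k _; rewrite mxE sqmod0.
  rewrite addr0 ler_pM2r // -[leRHS]mulrA ler_wpM2l //.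
  by apply: le_trans e0X _; rewrite /X; lra.
pose zeta tau := series_col (mc D) (z tau).
have forcing (tau : R) : 0 <= tau <= t ->
    sqnorm (S *m (G *m (mC1 D *m e tau + zeta tau)))
      <= (a0 * X + 2 * Ct * loop * Q) * expR (- delta * tau).
  move=> htau; rewrite [G *m _]mulmxDr mulmxDr !mulmxA.
  apply: le_trans (sqnormD_le _ _ _) _.
  have h1 : sqnorm (S *m G *m mC1 D *m e tau) <= k1 * (Cd * 2 * X * expR (- delta * tau)).
    by apply: le_trans (sqnorm_mulmx_le _ _ _ _) _; rewrite ler_wpM2l // eX.
  have h2 : sqnorm (S *m G *m zeta tau)
      <= Ct * ((l2sq (z 0) + loop * Q) * expR (- delta * tau)).
    apply: le_trans (sqnorm_series_col_le _ _ (S *m G) (mc D) (z tau) lc _ cc) _.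
      by apply: (sol_l2 sol); case/andP: htau.
    by rewrite ler_wpM2l // zQ.
  have h3 : Ct * ((l2sq (z 0) + loop * Q) * expR (- delta * tau))
      <= Ct * ((X + loop * Q) * expR (- delta * tau)).
    by rewrite ler_wpM2l // ler_pM2r // lerD2r /X; lra.
  set rhs := leRHS.
  have -> : rhs = 2 * (k1 * (Cd * 2 * X * expR (- delta * tau)))
                + 2 * (Ct * ((X + loop * Q) * expR (- delta * tau))).
    by rewrite /rhs /a0; ring.
  apply: lerD; rewrite ler_pM2l //.
  exact: le_trans h2 h3.
(* The margin delta / 2: [lyapunov] gives the rate delta, of which the
   announced decay uses one half. *)
have slow_bound (tau : R) : 0 <= tau <= t -> sqnorm (S *m w tau) <=
    (sqnorm (S *m w 0) + (a0 * X + 2 * Ct * loop * Q) / (delta / 2) ^+ 2)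
      * expR (- delta * tau).
  apply: (energy_decay _ _ _ (fun tau => S *m (G *m (mC1 D *m e tau + zeta tau)))
    _ _ _ _ ty).
  - by rewrite divr_gt0.
  - by do ! [done | apply: addr_ge0 | apply: mulr_ge0].
  - move=> q _; rewrite mulmxDr rdotDr lerD2r.
    rewrite (_ : delta / 2 + delta / 2 = delta); first exact: lyapunov.
    by field.
  - by move=> q /andP[q0 qt]; apply: forcing; rewrite !ltW.
(* Evaluate the bound on S w at the time r of the maximum, then absorb Q / 2. *)
have Qle : Q <= kap1 * X.
  have := slow_bound r rt; rewrite mulNr expRN ler_pdivlMr ?expR_gt0 // mulrC -/Q.
  have Sw0 : sqnorm (S *m w 0) <= kS * 3 * X.
    apply: le_trans (sqnorm_mulmx_le _ _ _ _) _; rewrite -mulrA ler_wpM2l //.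
    by apply: le_trans w0X _; rewrite /X; lra.
  have : 2 * Ct * loop / (delta / 2) ^+ 2 * Q <= 2^-1 * Q by rewrite ler_wpM2r.
  rewrite /kap1 !mulrDl; lra.
have tt : 0 <= t <= t by rewrite t0 lexx.
have QpX : Q / p <= kap1 / p * X by rewrite [leRHS]mulrAC ler_pM2r ?invr_gt0.
have hx1 : sqnorm (dsubmx (xh t))
    <= Cd * (1 + kB * (kap1 / p)) * X * expR (- delta * t).
  have to := fast_observer_trajectory D K0 G0 x z xh sol.
  have kBQ0 : 0 <= kB * (Q / p) by rewrite mulr_ge0.
  apply: le_trans (hCd _ _ _ t to kBQ0 _ t tt) _.
    move=> q /andP[q0 qt]; apply: le_trans (sqnorm_mulmx_le _ _ _ _) _.
    by rewrite -mulrA ler_wpM2l // hQ // !ltW.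
  rewrite ler_pM2r // -[leRHS]mulrA ler_wpM2l // mulrDl mul1r lerD //.
    have := sqnorm_ge0 _ (usubmx (xh 0)).
    have : sqnorm (xh 0) = sqnorm (usubmx (xh 0)) + sqnorm (dsubmx (xh 0)).
      by rewrite -sqnorm_col_mx vsubmxK.
    by rewrite /X; lra.
  by rewrite -mulrA ler_wpM2l.
apply: le_trans (total_norm_le x z xh t) _.
have := wQ t tt; have := eX t tt; have := zQ t tt; rewrite -/w -/e.
set E := expR _ in hx1 *; have EE : 0 < E by apply: E0.
move=> hz he hw.
have hw' : sqnorm (w t) <= kap1 / p * X * E by apply: le_trans hw _; rewrite ler_pM2r.
have hz' : l2sq (z t) <= (1 + loop * kap1) * X * E.
  apply: le_trans hz _; rewrite ler_pM2r // mulrDl mul1r lerD //; first by rewrite /X; lra.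
  by rewrite -mulrA ler_wpM2l.
have XE : 0 <= X * E by rewrite mulr_ge0 // ltW.
rewrite -/X.
have -> : kappa * E * X = X * E + (3 * (kap1 / p * X * E) + 2 * (Cd * 2 * X * E)
    + 3 * (Cd * (1 + kB * (kap1 / p)) * X * E) + (1 + loop * kap1) * X * E).
  by rewrite /kappa; ring.
apply: (@le_trans _ _ (0 + (3 * (kap1 / p * X * E) + 2 * (Cd * 2 * X * E)
    + 3 * (Cd * (1 + kB * (kap1 / p)) * X * E) + (1 + loop * kap1) * X * E))).
  by rewrite add0r; do 3 ?[apply: lerD => //]; rewrite ler_pM2l.
by rewrite lerD2r.
Qed.

End SmallGain.

(** * Exponential stability of the closed loop *)

Theorem theorem1 (R : realType) (nu ny : nat)
    (A : operator R) (B : 'cV[R[i]]_nu -> nat -> R[i])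
    (C : (nat -> R[i]) -> 'cV[R[i]]_ny)
    (hA : linear_operator A) (hB : bounded_input B) (hC : bounded_output C)
    (v : nat -> nat -> R[i]) (hv : generalized_eigenbasis A v)
    (delta : R) (hdelta : 0 < delta)
    (assumption1 : eventually_simple_stable A v)
    (assumption2_ctrl : exactly_controllable A B \/
                        approximately_controllable A B)
    (assumption2_obs : exactly_observable C A \/
                       approximately_observable C A)
    (n0 n1 : nat)
    (hn0 : number_of_eigenvalues A (fun s => - delta <= complex.Re s) n0)
    (hn1 : number_of_eigenvalues A (fun s => complex.Re s < - delta /\
                                      algebraically_multiple A s) n1)
    (n : nat) (hn : (n0 + n1 <= n)%N) (hA1 : (n0 < n)%N)
    (D : modal_data R nu ny n0 (n - n0))
    (hD : decomposed_form delta A B C D)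
    (K0 : 'M[R[i]]_(nu, n0)) (G0 : 'M[R[i]]_(n0, ny))
    (P0 : 'M[R[i]]_(n0 + n0)) (hP0 : posdef P0)
    (hLMI : mxprec (P0 *m mF0 D K0 G0 + (mF0 D K0 G0)^t* *m P0)
                   (- (2 * delta)%:C *: P0))
    (hrho : rho delta D K0 G0 P0 <= 1) :
  exponentially_stable delta D
    (block_mx (mA0 D + G0 *m mC0 D) (G0 *m mC1 D) 0 (mA1 D))
    (col_mx (- G0) 0)
    (mB D)
    (row_mx K0 0).
Proof.
have [Phi hPhi] := decomposed_conjugates hD.
have trig1 := jordan_trig _ _ (decomposed_jordan1 hD).
have eig1 k := is_trig_eigenvalue _ _ k trig1.
have rate1 k : complex.Re (mA1 D k k) < - delta.
  exact: le_lt_trans (le_sigma_max _ _ _ (eig1 k)) (decomposed_A1 hD).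
have m0 : (0 < n - n0)%N by rewrite subn_gt0.
(* sigma_min of an empty matrix would be 0: the order n is larger than n0. *)
have smin : sigma_min (mA1 D) < - delta.
  exact: le_lt_trans (sigma_min_le _ _ _ (eig1 (Ordinal m0))) (rate1 _).
pose s := `|sigma_min (mA1 D)|.
have sE : s = - sigma_min (mA1 D).
  by rewrite /s ltr0_norm //; apply: lt_trans smin _; rewrite oppr_lt0.
have ds : delta < s by rewrite sE ltrNr.
have [S PS] := psd_factor P0 hP0.1 (fun v => posdef_rdot_ge0 _ P0 v hP0).
have normS (u : 'cV_(n0 + n0)) : sqnorm (S *m u) = rdot u (P0 *m u).
  by rewrite -rdotvv rdot_mull PS mulmxA.
pose b i := sigma_max (K0^t* *m (mb D i)^t* *m mb D i *m K0).
have bE i : b i = sigma_max ((mb D i *m K0)^t* *m (mb D i *m K0)).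
  by rewrite /b trmx_mul map_mxM !mulmxA.
have b0 i : 0 <= b i by rewrite bE; apply: sigma_max_gram_ge0.
have cb : cvgn (series b).
  apply: series_le_cvg (input_gain_cvg _ _ _ _ _ hB hPhi K0) => //.
    by move=> i; apply: sqfrob_ge0.
  by move=> i; rewrite bE; apply: sigma_max_gram_le.
have b_gain i (u : 'cV_n0) : sqmod ((mb D i *m (K0 *m u)) 0 0) <= b i * sqnorm u.
  apply: le_trans (sqmod_le_sqnorm _ _ 0) _.
  by rewrite mulmxA bE; apply: sqnorm_le_sigma_max_gram.
pose G := col_mx (- G0) G0.
pose c i := sigma_max ((mc D i)^t* *m G^t* *m P0 *m G *m mc D i).
have cE : c = fun i => sqnorm (S *m G *m mc D i).
  apply/funext => i; rewrite /c sigma_max_mx11 -rdotvv /rdot PS.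
  by rewrite !trmx_mul !map_mxM !mulmxA.
have [p p0 [coercive small]] : exists2 p : R, 0 < p &
    (forall u : 'cV_(n0 + n0), p * sqnorm u <= sqnorm (S *m u)) /\
    16 * limn (series b) * limn (series c) <= delta ^+ 2 * p * (s - delta) * s.
  (* For n0 = 0 the quotient rho is 0 because sigma_min P0 = 0; but then beta
     vanishes, and p can be any positive number. *)
  have [n00|n0_gt0] := posnP n0.
    exists 1 => //; split.
      by move=> u; rewrite [sqnorm u]sqnorm_dim0 ?n00 // mulr0 sqnorm_ge0.
    have b00 i : b i = 0 by apply: sigma_max_dim0.
    have -> : limn (series b) = 0.
      rewrite (finite_support_series b 0 (fun i _ => b00 i)).2.
      by rewrite /series /= big_geq.
    have s0 : 0 <= s by exact: normr_ge0.
    by rewrite mulr0 mul0r mulr1 !mulr_ge0 ?subr_ge0 ?(ltW ds) ?(ltW hdelta).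
  have pos : 0 < sigma_min P0 by apply: posdef_sigma_min_gt0; rewrite // addn_gt0 n0_gt0.
  exists (sigma_min P0) => //; split.
    by move=> u; rewrite normS; case/andP: (rayleigh_bounds P0 hP0.1 u).
  have den0 : 0 < delta ^+ 2 * sigma_min P0 * (s - delta) * s.
    by rewrite !mulr_gt0 ?exprn_gt0 ?subr_gt0 //; apply: lt_trans ds.
  by move: hrho; rewrite /rho ler_pdivrMr // mul1r.
have lyapunov (u : 'cV_(n0 + n0)) :
    rdot (S *m u) (S *m (mF0 D K0 G0 *m u)) <= - delta * sqnorm (S *m u).
  have := posdef_rdot_ge0 _ _ u hLMI.
  rewrite mulmxBl rdotDr rdotNr PS gram_lyapunov -PS.
  rewrite scaleNr mulNmx rdotNr -scalemxAl rdotZr -normS.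
  lra.
apply: (@small_gain_stable _ _ _ _ _ _ _ _ S delta p s b) => //.
- exact: (tail_output_l2 _ _ _ _ _ hC hPhi).
- exact: (output_gain_cvg _ _ _ _ _ hC hPhi).
- by move=> i; rewrite sE opprK ltW // (decomposed_tail hD).
- by move=> k; rewrite ltW.
- by rewrite -/G -cE.
Qed.
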